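(* Let $s,t,d,h\in\mathbb{N}$ and $\rho\in\mathbb{R}_{\ge0}$. Let $T$ be a fixed forest with $h$ vertices, and let $t':=(2d(s+h-1)+1)(t-1)+1+sd$. Let $\mathcal{G}$ be a graph class such that $\rho(\mathcal{G})\le\rho$, every graph with treewidth at most $s-1$ is in $\mathcal{G}$, and no graph in $\mathcal{G}$ contains a $(1,2h+s-1)$-model of $K_{s,t}$. Then no graph in $\mathcal{G}^{(d)}$ contains a $(1,h)$-model of $K_{s,t'}$, and $$C(T,\mathcal{G}^{(d)},n)=\Theta(n^{\alpha_{s-1}(T)})\quad(n\to\infty).$$
   Context: All graphs are finite, simple and undirected. For a graph $G$, $\rho(G):=|E(G)|/|V(G)|$ and for a class $\mathcal{G}$, $\rho(\mathcal{G}):=\sup\{\rho(G):G\in\mathcal{G}\}$. For $d\in\mathbb{N}$, $G^{(d)}$ is the graph obtained from $G$ by adding a clique on $N_G(v)$ for each vertex $v$ with $\deg_G(v)\le d$, and $\mathcal{G}^{(d)}:=\{G^{(d)}:G\in\mathcal{G}\}$. $C(H,G)$ is the number of subgraphs of $G$ isomorphic to $H$ and $C(H,\mathcal{G},n):=\max\{C(H,G):G\in\mathcal{G},|V(G)|=n\}$. For $s\in\mathbb{N}_0$, $\alpha_s(G)$ is the maximum size of a stable set in the subgraph of $G$ induced by the vertices of degree at most $s$ in $G$. For $p,q\in\mathbb{N}$, a $(p,q)$-model of $K_{a,b}$ in $G$ is a family $\{X_1,\dots,X_a;Y_1,\dots,Y_b\}$ of pairwise disjoint connected subgraphs of $G$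 such that for each $i\in[a]$, $j\in[b]$ there is an edge of $G$ between $X_i$ and $Y_j$, $|V(X_i)|\le p$, and $|V(Y_j)|\le q$. $\Theta(n^a)$ means bounded above and below by positive constant multiples of $n^a$ for all sufficiently large $n$.
   Formalization: The Θ-estimate is proved only when s ≥ 2 or T has no edges; for s = 1 and T with an edge it fails as stated (s=t=d=1, T=K_2, G all edgeless graphs: C = 0 but α_0(T) = 0). *)

(* Defs.v *)
From HB Require Import structures.
From mathcomp Require Import all_boot all_order all_algebra.
From mathcomp Require Import boolp.

Set Implicit Arguments.
Unset Strict Implicit.
Unset Printing Implicit Defensive.

Record sgraph := SGraph {
  vertex :> finType;
  adj : rel vertex;
  adj_sym : symmetric adj;
  adj_irr : irreflexive adj }.

Definition edges (G : sgraph) : {set {set G}} :=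
  [set [set p.1; p.2] | p : G * G & adj p.1 p.2].

Definition deg (G : sgraph) (v : G) : nat := #|[set x | adj v x]|.

Definition isomorphic (G H : sgraph) : Prop :=
  exists2 f : G -> H, bijective f & forall x y, adj (f x) (f y) = adj x y.

Definition graph_connected (G : sgraph) : Prop :=
  (0 < #|G|)%N /\ forall x y : G, connect (@adj G) x y.

Definition forest (G : sgraph) : Prop :=
  forall c : seq G, (2 < size c)%N -> ~ ucycle (@adj G) c.

Definition tree (G : sgraph) : Prop := graph_connected G /\ forest G.

Definition subgraph (G : sgraph) : Type :=
  {S : {set G} * {set {set G}} |
    (S.2 \subset edges G) && [forall e in S.2, e \subset S.1]}.

Definition sub_vertices (G : sgraph) (S : subgraph G) : {set G} := (val S).1.

Definition sub_edges (G : sgraph) (S : subgraph G) : {set {set G}} := (val S).2.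

Definition sub_adj (G : sgraph) (S : subgraph G) :
    rel {x : G | x \in sub_vertices S} :=
  fun u v => [set val u; val v] \in sub_edges S.

Lemma sub_adj_sym (G : sgraph) (S : subgraph G) : symmetric (@sub_adj G S).
Proof. by move=> u v; rewrite /sub_adj finset.setUC. Qed.

Lemma sub_adj_irr (G : sgraph) (S : subgraph G) : irreflexive (@sub_adj G S).
Proof.
move=> u; apply/negP => uS.
have /andP[/subsetP /(_ _ uS) /imsetP[[x y]]] := valP S.
rewrite inE /= => xy /setP E _.
have ux : x = val u by apply/eqP; have := E x; rewrite !inE eqxx orbb.
have uy : y = val u by apply/eqP; have := E y; rewrite !inE eqxx orbb orbT.
by move: xy; rewrite ux uy adj_irr.
Qed.

Definition graph_of_subgraph (G : sgraph) (S : subgraph G) : sgraph :=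
  SGraph (@sub_adj_sym G S) (@sub_adj_irr G S).

Definition induced (G : sgraph) (W : {set G}) : sgraph :=
  @SGraph {x : G | x \in W} (fun u v => adj (val u) (val v))
    (fun u v => adj_sym (val u) (val v)) (fun u => adj_irr (val u)).

Definition stable (G : sgraph) (S : {set G}) : bool :=
  [forall x in S, forall y in S, ~~ adj x y].

Definition stability_number (G : sgraph) : nat :=
  \max_(S : {set G} | stable S) #|S|.

Definition alpha (s : nat) (G : sgraph) : nat :=
  stability_number (induced [set v : G | (deg v <= s)%N]).

Record tree_decomposition (G : sgraph) := TreeDecomposition {
  td_tree : sgraph;
  td_bag : td_tree -> {set G};
  td_treeP : tree td_tree;
  td_edge : forall x y : G, adj x y ->
    exists t, (x \in td_bag t) && (y \in td_bag t);
  td_vertex : forall x : G, graph_connected (induced [set t | x \in td_bag t]) }.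

Arguments td_bag {G} D t : rename.

(* The predecessor is truncated, so that the null graph gets treewidth 0
   instead of -1. *)
Definition td_width (G : sgraph) (D : tree_decomposition G) : nat :=
  (\max_t #|td_bag D t|).-1.

Definition single_vertex : sgraph :=
  @SGraph unit (fun _ _ => false) (fun _ _ => erefl) (fun _ => erefl).

Lemma td_trivial (G : sgraph) :
  exists k, `[< exists D : tree_decomposition G, td_width D = k >].
Proof.
have treeP : tree single_vertex.
  split; first by split; [rewrite card_unit | move=> [] []; apply: connect0].
  by move=> [|[] [|[] c]].
have edgeP (x y : G) : adj x y ->
    exists t : single_vertex, (x \in [set: G]) && (y \in [set: G]).
  by exists tt; rewrite !inE.
have vertexP (x : G) : graph_connected (induced [set t : single_vertex | x \in [set: G]]).
  have tP : tt \in [set t : single_vertex | x \in [set: G]] by rewrite !inE.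
  split; first by apply/card_gt0P; exists (exist _ tt tP).
  move=> u v; suff -> : u = v by apply: connect0.
  by apply: val_inj; case: (val u) (val v) => -[].
by eexists; apply/asboolP; exists (TreeDecomposition treeP edgeP vertexP).
Qed.

Definition treewidth (G : sgraph) : nat := ex_minn (td_trivial G).

(* The copies of H are counted as subgraphs, not as embeddings of H. *)
Definition copies (H G : sgraph) : nat :=
  #|[set S : subgraph G | `[< isomorphic H (graph_of_subgraph S) >]]|.

Definition has_model (p q a b : nat) (G : sgraph) : Prop :=
  exists (X : 'I_a -> subgraph G) (Y : 'I_b -> subgraph G),
  [/\ [/\ forall i, graph_connected (graph_of_subgraph (X i)) &
          forall j, graph_connected (graph_of_subgraph (Y j))],
      [/\ forall i i', i != i' ->
            [disjoint sub_vertices (X i) & sub_vertices (X i')],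
          forall j j', j != j' ->
            [disjoint sub_vertices (Y j) & sub_vertices (Y j')] &
          forall i j, [disjoint sub_vertices (X i) & sub_vertices (Y j)]],
      forall i j, exists x y,
        [/\ x \in sub_vertices (X i), y \in sub_vertices (Y j) & adj x y] &
      [/\ forall i, (#|sub_vertices (X i)| <= p)%N &
          forall j, (#|sub_vertices (Y j)| <= q)%N]].

Definition power_adj (d : nat) (G : sgraph) : rel G := fun x y =>
  (x != y) &&
  (adj x y || [exists v, [&& (deg v <= d)%N, adj v x & adj v y]]).

Lemma power_adj_sym d G : symmetric (@power_adj d G).
Proof.
move=> x y; rewrite /power_adj eq_sym adj_sym; congr (_ && (_ || _)).
by apply: eq_existsb => v; rewrite [adj v x && _]andbC.
Qed.

Lemma power_adj_irr d G : irreflexive (@power_adj d G).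
Proof. by move=> x; rewrite /power_adj eqxx. Qed.

(* G^(d): cliques are added on the neighbourhoods of all vertices whose degree
   in the original graph G is at most d. *)
Definition power (d : nat) (G : sgraph) : sgraph :=
  SGraph (@power_adj_sym d G) (@power_adj_irr d G).

From mathcomp Require Import classical_sets reals ereal topology.
From mathcomp Require Import normedtype landau sequences.

Import Order.TTheory GRing.Theory Num.Theory.
Import numFieldNormedType.Exports.

(* A graph class is an arbitrary collection of graphs; closure under isomorphism
   is not required.  The type set sgraph would be a universe inconsistency. *)
Definition graph_class : Type := sgraph -> Prop.

Definition power_class (d : nat) (C : graph_class) : graph_class :=
  fun H => exists2 G, C G & H = power d G.

(* The null graph has density 0 because x / 0 = 0. *)
Definition density (R : realType) (G : sgraph) : R :=
  (#|edges G|%:R / #|G|%:R)%R.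

Definition class_density (R : realType) (C : graph_class) : \bar R :=
  ereal_sup [set x : \bar R | exists2 G, C G & x = (density R G)%:E]%classic.

(* An n-vertex graph has at most 2 ^ n * 2 ^ (2 ^ n) subgraphs, so the bound on
   k below only makes the range of the maximum finite; see copies_le_max and
   max_copies_attained.  The maximum is 0 if C has no n-vertex graph. *)
Definition max_copies (H : sgraph) (C : graph_class) (n : nat) : nat :=
  \max_(k < (2 ^ n * 2 ^ (2 ^ n)).+1 |
        `[< exists G, [/\ C G, #|G| = n & copies H G = k] >]) k.

Lemma copies_bound H (G : sgraph) :
  (copies H G <= 2 ^ #|G| * 2 ^ (2 ^ #|G|))%N.
Proof.
rewrite (leq_trans (max_card _)) // card_sig (leq_trans (max_card _)) //.
have card_set (A : finType) : #|{: {set A}}| = (2 ^ #|A|)%N.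
  rewrite -[#|A|]cardsT -card_powerset; apply: eq_card => B.
  by rewrite powersetE finset.subsetT.
by rewrite card_prod !card_set.
Qed.

Lemma copies_le_max H (C : graph_class) (G : sgraph) :
  C G -> (copies H G <= max_copies H C #|G|)%N.
Proof.
move=> CG; have lt := copies_bound H G; rewrite -ltnS in lt.
apply: (@leq_bigmax_cond _ _ (fun k : 'I_ _ => k : nat) (Ordinal lt)).
by apply/asboolP; exists G.
Qed.

Lemma max_copies_attained H (C : graph_class) n :
  (exists2 G, C G & #|G| = n) ->
  exists G, [/\ C G, #|G| = n & copies H G = max_copies H C n].
Proof.
case=> G CG Gn; have lt := copies_bound H G; rewrite Gn -ltnS in lt.
have PG : `[< exists G', [/\ C G', #|G'| = n &
                            copies H G' = Ordinal lt :> nat] >].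
  by apply/asboolP; exists G.
rewrite /max_copies (bigop.bigmax_eq_arg (Ordinal lt)) //.
by case: arg_maxnP => // k /asboolP.
Qed.

(* Main.v *)
(** Both parts rest on models of K_(s,k) whose first side consists of single
vertices.

Given such a model in G^(d), subdivide each added edge among the at most s+h-1
edges used by a branch set Y_j by a vertex of degree at most d. Such a vertex has
a neighbour in Y_j, so at most s*d branch sets use some x_i this way, and each of
the others meets few of the rest: the "conflict" digraph has outdegree at most
d(s+h-1), hence a stable set of size t, which gives a model in G.

Upper bound. Low-degree vertices of T are covered by alpha_(s-1)(T) vertices and
edges, so G^(d), having linearly many edges, offers O(n^alpha) placements for
them. If one placement extended to too many embeddings, a sunflower argument
would give many embeddings agreeing on a core K and disjoint elsewhere. A
component Q of T - K has all degrees at least s >= 2, and by counting edges in a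
forest it has at least s neighbours in K; these and the images of Q form a
forbidden model.

Lower bound. Blow up a maximum stable set of low-degree vertices of T; the result
still has treewidth at most s-1. *)

Require Import Defs.
From mathcomp Require Import all_boot all_order all_algebra.
From mathcomp Require Import boolp zify.

Set Implicit Arguments.
Unset Strict Implicit.
Unset Printing Implicit Defensive.

(** * Connected sets and models *)

(** Stating connectivity through cuts lets sets grow edge by edge and pass between [G] and
    [power d G] without handling paths. *)
Definition connset (G : sgraph) (A : {set G}) : Prop :=
  A != set0 /\
  forall B : {set G}, B \subset A -> B != set0 -> B != A ->
    exists x y, [/\ x \in B, y \in A :\: B & adj x y].

Lemma adjacent_in_edges (G : sgraph) (x y : G) :
  ([set x; y] \in edges G) = adj x y.
Proof.
apply/imsetP/idP => [[[u v]]|xy]; last by exists (x, y); rewrite ?inE.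
rewrite inE /= => uv E.
have xE : x \in [set u; v] by rewrite -E !inE eqxx.
have yE : y \in [set u; v] by rewrite -E !inE eqxx orbT.
have uE : u \in [set x; y] by rewrite E !inE eqxx.
have vE : v \in [set x; y] by rewrite E !inE eqxx orbT.
have vu : u != v by apply: contraTneq uv => ->; rewrite adj_irr.
move: xE yE uE vE; rewrite !inE.
by do 2![case/orP => /eqP ?]; subst; rewrite ?orbb // 1?adj_sym // => /eqP ? /eqP ?; subst;
  rewrite eqxx in vu.
Qed.

Lemma connset_of_subgraph (G : sgraph) (S : subgraph G) :
  graph_connected (graph_of_subgraph S) -> connset (sub_vertices S).
Proof.
case=> n0 con; split; first by case/card_gt0P: n0 => -[x xS] _; apply/set0Pn; exists x.
move=> B BA /set0Pn[b bB] BneA.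
have [a aA aB] : exists2 a, a \in sub_vertices S & a \notin B.
  by apply/subsetPn; apply: contra BneA => AB; rewrite finset.eqEsubset BA.
apply: contrapT => noedge.
have bA := subsetP BA _ bB.
pose b' : graph_of_subgraph S := exist _ b bA.
pose a' : graph_of_subgraph S := exist _ a aA.
have clB : closed (@adj (graph_of_subgraph S)) [pred z : graph_of_subgraph S | val z \in B].
  apply: intro_closed; first exact: (@sym_connect_sym _ _ (@sub_adj_sym _ S)).
  move=> u v uv uB; apply: contrapT => /negP vB; apply: noedge.
  exists (val u), (val v); split=> //; first by rewrite inE vB (valP v).
  rewrite -adjacent_in_edges; have /andP[/subsetP sE _] := valP S.
  exact: sE.
have := closed_connect clB (con b' a').
by rewrite !inE /= bB (negPf aB).
Qed.

Definition induced_pair (G : sgraph) (A : {set G}) :=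
  (A, [set e in edges G | e \subset A]).

Lemma induced_pairP (G : sgraph) (A : {set G}) :
  let S := induced_pair A in
  (S.2 \subset edges G) && [forall e in S.2, e \subset S.1].
Proof.
apply/andP; split; first by apply/subsetP => e; rewrite inE => /andP[].
by apply/forall_inP => e; rewrite inE => /andP[].
Qed.

Definition induced_subgraph (G : sgraph) (A : {set G}) : subgraph G :=
  exist _ (induced_pair A) (induced_pairP A).

Lemma connset_induced_subgraph (G : sgraph) (A : {set G}) :
  connset A -> graph_connected (graph_of_subgraph (induced_subgraph A)).
Proof.
case=> /set0Pn[a aA] cut; split; first by apply/card_gt0P; exists (exist _ a aA).
move=> x y; pose c := connect (@adj (graph_of_subgraph (induced_subgraph A))) x.
pose B : {set G} := [set val z | z : graph_of_subgraph (induced_subgraph A) & c z].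
have xB : val x \in B by apply/imsetP; exists x; rewrite ?inE //; apply: connect0.
have BA : B \subset A by apply/subsetP => _ /imsetP[z _ ->]; apply: (valP z).
have [BeA|BneA] := eqVneq B A.
  have : val y \in B by rewrite BeA (valP y).
  by case/imsetP => z; rewrite inE => cz /val_inj ->.
have [|u [v [/imsetP[z]]]] := cut B BA _ BneA; first by apply/set0Pn; exists (val x).
rewrite inE => cz -> {u}; rewrite inE => /andP[vB vA] zv.
case/imsetP: vB; exists (exist _ v vA) => //; rewrite inE /c.
apply: connect_trans cz (connect1 _); rewrite /= /sub_adj /= inE adjacent_in_edges zv /=.
by apply/subsetP => w; rewrite !inE => /orP[]/eqP->; rewrite ?(valP z).
Qed.

(* Only (1,q)-models occur, so each X_i is recorded by its unique vertex. *)
Definition vertex_model (q a b : nat) (G : sgraph)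
    (x : 'I_a -> G) (Y : 'I_b -> {set G}) : Prop :=
  [/\ injective x,
      forall j, connset (Y j),
      forall j j', j != j' -> [disjoint Y j & Y j'],
      forall i j, x i \notin Y j &
      (forall i j, exists2 y, y \in Y j & adj (x i) y) /\
      (forall j, #|Y j| <= q)].

Lemma vertex_model_has_model q a b (G : sgraph) (x : 'I_a -> G) Y :
  @vertex_model q a b G x Y -> has_model 1 q a b G.
Proof.
case=> injx conY disY xY [adjxY cardY].
exists (fun i => induced_subgraph [set x i]), (fun j => induced_subgraph (Y j)).
split; first (split=> [i|j]; last exact: connset_induced_subgraph).
- apply: connset_induced_subgraph; split; first by apply/set0Pn; exists (x i); rewrite inE.
  by move=> B; rewrite subset1 => /orP[]/eqP->; rewrite eqxx.
- split=> // [i i' ii'|i j] /=.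
    by rewrite disjoints1 inE (inj_eq injx).
  by rewrite disjoints1 xY.
- move=> i j; have [y yY xy] := adjxY i j.
  by exists (x i), y; split=> //; rewrite inE.
- by split=> // i; rewrite cards1.
Qed.

Lemma has_model_vertex_model q a b (G : sgraph) :
  has_model 1 q a b G -> exists x Y, @vertex_model q a b G x Y.
Proof.
case=> X [Y [[conX conY] [disX disY disXY] adjXY [cardX cardY]]].
have /choice[x xX] i : exists x, sub_vertices (X i) = [set x].
  have [/set0Pn[x xX] _] := connset_of_subgraph (conX i).
  exists x; apply/esym/eqP; rewrite eqEcard finset.sub1set xX cards1; exact: cardX.
exists x, (fun j => sub_vertices (Y j)); split=> //.
- move=> i i' xx; apply/eqP; apply: contrapT => /negP /disX.
  by rewrite !xX xx disjoints1 inE eqxx.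
- by move=> j; apply: connset_of_subgraph.
- by move=> i j; have := disXY i j; rewrite xX disjoints1.
- split=> // i j; have [u [v [uX vY uv]]] := adjXY i j.
  by exists v => //; move: uX; rewrite xX inE => /eqP <-.
Qed.

(** A cut [B] either misses [A], and then any vertex of it has an edge to [A]; or splits [A]; or
    contains [A] and omits some [m] in [M], which has an edge to [A]. *)
Lemma connset_extend (G : sgraph) (A M : {set G}) :
  connset A -> (forall m, m \in M -> exists2 a, a \in A & adj m a) ->
  connset (A :|: M).
Proof.
case=> /set0Pn[a0 a0A] cut near; split.
  by apply/set0Pn; exists a0; rewrite inE a0A.
move=> B BAM /set0Pn[b bB] BneAM.
have [BA0|BA0] := eqVneq (B :&: A) set0.
  have bM : b \in M.
    have := subsetP BAM _ bB; rewrite inE => /orP[bA|//].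
    by have := finset.in_set0 b; rewrite -BA0 inE bB bA.
  have [a aA ba] := near b bM; exists b, a; split=> //; rewrite !inE aA andbT.
  by apply/negP => aB; have := finset.in_set0 a; rewrite -BA0 inE aA aB.
have [BAA|BAneA] := eqVneq (B :&: A) A; last first.
  have [x [y [xB yA xy]]] := cut _ (finset.subsetIr B A) BA0 BAneA.
  exists x, y; split=> //; first by move: xB; rewrite inE => /andP[].
  by move: yA; rewrite !inE; case: (y \in A); rewrite ?andbT ?andbF.
have [m mAM mB] : exists2 m, m \in A :|: M & m \notin B.
  by apply/subsetPn; apply: contra BneAM => AB; rewrite finset.eqEsubset BAM.
have AB x : x \in A -> x \in B by rewrite -BAA inE => /andP[].
have mM : m \in M.
  by move: mAM; rewrite inE => /orP[/AB mB'|//]; rewrite mB' in mB.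
have [a aA ma] := near m mM.
by exists a, m; split; rewrite 1?adj_sym ?inE ?mB ?mM ?orbT //; apply: AB.
Qed.

Lemma connset_adjoin (G : sgraph) (A : {set G}) (a m : G) :
  connset A -> a \in A -> adj a m -> connset (m |: A).
Proof.
move=> cA aA am; rewrite finset.setUC; apply: connset_extend => // x.
by rewrite inE => /eqP ->; exists a; rewrite // adj_sym.
Qed.

(** Picking a point of [W] in each [Y j] is injective by disjointness. With [W] around a vertex of
    low degree, this bounds how many branch sets come near it. *)
Lemma card_meeting_le (G : finType) (I : finType) (Y : I -> {set G}) (W : {set G})
    (J : {set I}) :
  (forall j j', j != j' -> [disjoint Y j & Y j']) ->
  (forall j, j \in J -> exists2 y, y \in Y j & y \in W) ->
  #|J| <= #|W|.
Proof.
move=> disY meet.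
have [->|[j0 /meet[y0 _ _]]] := set_0Vmem J; first by rewrite cards0.
pose f j := odflt y0 [pick y in Y j :&: W].
have fP j : j \in J -> f j \in Y j :&: W.
  case/meet => y yY yW; rewrite /f; case: pickP => //= /(_ y).
  by rewrite !inE yY yW.
rewrite -(@card_in_imset _ _ f J).
  apply: subset_leq_card; apply/subsetP => _ /imsetP[j /fP + ->].
  by rewrite inE => /andP[].
move=> j j' /fP + /fP; rewrite !inE => /andP[yj _] /andP[yj' _] ff.
apply/eqP; apply: contrapT => /negP /disY; rewrite disjoint_subset.
by move/subsetP/(_ _ yj); rewrite ff inE yj'.
Qed.

(** * Models in power graphs *)

(** These vertices may subdivide an added edge at [A]; the neighbour in [A] later limits how many
    branch sets use the same one. *)
Definition middle (d : nat) (G : sgraph) (A : {set G}) (m : G) : Prop :=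
  deg m <= d /\ exists2 a, a \in A & adj m a.

Lemma power_adjP d (G : sgraph) (x y : G) :
  power_adj d x y ->
  adj x y \/ exists w, [/\ deg w <= d, adj w x & adj w y].
Proof.
case/andP=> _ /orP[|/existsP[w /and3P[]]]; first by left.
by right; exists w.
Qed.

(* A spanning tree of A in the power graph uses #|A| - 1 edges, each of which
   is an edge of G or is subdivided by one middle vertex. *)
Lemma connset_power d (G : sgraph) (A : {set G}) :
  @connset (power d G) A ->
  exists M : {set G}, [/\ #|M| <= #|A|.-1, connset (A :|: M) &
    forall m, m \in M -> middle d A m].
Proof.
case=> A0' cut'.
have A0 : A != set0 :> {set G} := A0'.
have cut : forall B : {set G}, B \subset A -> B != set0 -> B != A ->
    exists x y : G, [/\ x \in B, y \in A :\: B & power_adj d x y] := cut'.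
move: A0 cut => {A0' cut'} A0 cut.
have A1 : 0 < #|A| by rewrite card_gt0; exact: A0.
suff grow k : k < #|A| -> exists B M : {set G},
    [/\ B \subset A, #|B| = k.+1, #|M| <= k, connset (B :|: M) &
        forall m, m \in M -> middle d A m].
  have [|B [M [BA cB cM con mid]]] := grow #|A|.-1; first by rewrite prednK.
  have BeA : B = A by apply/eqP; rewrite eqEcard BA cB prednK //= leqnn.
  by exists M; rewrite BeA in con.
elim: k => [_|k IH kA].
  case/set0Pn: A0 => a aA; exists [set a], set0; rewrite sub1set aA cards1 cards0 finset.setU0.
  split=> //; last by move=> m; rewrite inE.
  split; first by apply/set0Pn; exists a; rewrite inE.
  by move=> B; rewrite subset1 => /orP[]/eqP->; rewrite eqxx.
have [B [M [BA cB cM con mid]]] := IH (ltnW kA).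
have B0 : B != set0 by rewrite -card_gt0 cB.
have BneA : B != A by apply: contraTneq kA => <-; rewrite cB ltnn.
have [b [a [bB]]] := cut B BA B0 BneA.
rewrite inE => /andP[aB aA] /power_adjP ba.
have cB' : #|a |: B| = k.+2 by rewrite cardsU1 aB cB.
have B'A : a |: B \subset A by rewrite finset.subUset sub1set aA.
have bBM : b \in B :|: M by rewrite inE bB.
case: ba => [ba|[w [dw wb wa]]].
  exists (a |: B), M; split=> //; first by rewrite ltnW.
  by rewrite -finset.setUA; apply: connset_adjoin bBM ba.
exists (a |: B), (w |: M); split=> //.
- by rewrite cardsU1; case: (_ \notin _) => //=; rewrite ltnW.
- rewrite -finset.setUA [B :|: _]finset.setUCA.
  apply: (@connset_adjoin _ _ w) => //; last by rewrite !inE eqxx.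
  by apply: connset_adjoin bBM _ => //; rewrite adj_sym.
- move=> m; rewrite !inE => /orP[/eqP ->|/mid //]; split=> //.
  by exists a.
Qed.

Lemma card_bigcup_le (T I : finType) (P : pred I) (F : I -> {set T}) :
  #|\bigcup_(i | P i) F i| <= \sum_(i | P i) #|F i|.
Proof.
elim/big_rec2: _ => [|i m U _ IH]; first by rewrite cards0.
by rewrite (leq_trans (leq_card_setU _ _)) // leq_add2l.
Qed.

Lemma card_set_sum (T : finType) (J : {set T}) (P : pred T) :
  #|[set y in J | P y]| = \sum_(y in J) P y.
Proof.
rewrite -sum1_card big_mkcond [RHS]big_mkcond; apply: eq_bigr => y _.
by rewrite inE; case: (y \in J); case: (P y).
Qed.

(** At most [q - 1] middle vertices connect the branch set, and at most one for each of the [a]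
    vertices [x i] realises its edge to [A]. *)
Lemma power_branch d a q (G : sgraph) (x : 'I_a -> G) (A : {set G}) :
  @connset (power d G) A ->
  (forall i, exists2 y, y \in A & power_adj d (x i) y) -> #|A| <= q ->
  exists M : {set G}, [/\ #|M| <= a + q - 1, connset (A :|: M),
    forall m, m \in M -> middle d A m &
    forall i, exists2 z, z \in A :|: M & adj (x i) z].
Proof.
move=> conA near cardA.
have [M [cM conM mid]] := connset_power conA.
have /choice[o oP] i : exists o : {set G}, [/\ #|o| <= 1,
    forall m, m \in o -> middle d A m &
    exists2 z, z \in A :|: o & adj (x i) z].
  have [y yA /power_adjP[xy|[w [dw wx wy]]]] := near i.
    exists set0; rewrite cards0; split=> // [m|]; first by rewrite inE.
    by exists y; rewrite ?inE ?yA.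
  exists [set w]; rewrite cards1; split=> // [m|].
    by rewrite inE => /eqP->; split=> //; exists y.
  by exists w; rewrite ?inE ?eqxx ?orbT // adj_sym.
pose N := \bigcup_i o i.
have midN m : m \in N -> middle d A m.
  by case/bigcupP => i _; case: (oP i) => _ + _ => /[apply].
have cN : #|N| <= a.
  apply: leq_trans (card_bigcup_le _ _) _; rewrite -[leqRHS]card_ord -sum1_card.
  by apply: leq_sum => i _; case: (oP i).
have A0 : 0 < #|A| by rewrite card_gt0; case: conA.
exists (M :|: N); split.
- by rewrite (leq_trans (leq_card_setU _ _)) //; lia.
- rewrite finset.setUA; apply: connset_extend => // m /midN[_ [z zA mz]].
  by exists z; rewrite ?inE ?zA.
- by move=> m; rewrite inE => /orP[/mid|/midN].
- move=> i; have [_ _ [z + xz]] := oP i; rewrite inE => zA.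
  exists z => //; rewrite !inE; case/orP: zA => [->//|zo].
  by rewrite (subsetP (bigcup_sup i _) _ zo) ?orbT.
Qed.

(* In-degrees average to at most k, so some vertex has at most 2k neighbours;
   keep it and discard them. *)
Lemma stable_of_outdegree (I : finType) (r : rel I) (k t : nat) (J : {set I}) :
  (forall j, j \in J -> #|[set l in J | r j l]| <= k) ->
  (2 * k + 1) * t < #|J| ->
  exists2 L : {set I}, L \subset J /\ #|L| = t.+1 &
    {in L &, forall j l, j != l -> ~~ r j l}.
Proof.
elim: t J => [|t IH] J outk; rewrite ?muln0 => cJ.
  case/card_gt0P: cJ => j jJ; exists [set j]; first by rewrite sub1set cards1.
  by move=> u v; rewrite !inE => /eqP-> /eqP->; rewrite eqxx.
have [j jJ ink] : exists2 j, j \in J & #|[set l in J | r l j]| <= k.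
  apply: contrapT => no.
  have : \sum_(j in J) k.+1 <= \sum_(j in J) #|[set l in J | r l j]|.
    apply: leq_sum => j jJ; rewrite ltnNge; apply/negP => le; apply: no.
    by exists j.
  have -> : \sum_(j in J) #|[set l in J | r l j]| =
            \sum_(l in J) #|[set j in J | r l j]|.
    under eq_bigr do rewrite card_set_sum; under [RHS]eq_bigr do rewrite card_set_sum.
    by rewrite exchange_big.
  move/leq_trans => /(_ (\sum_(l in J) k)); rewrite leq_sum // => /(_ isT).
  rewrite !sum_nat_const leq_mul2l ltnn orbF => /eqP J0.
  by rewrite J0 in cJ.
pose D := j |: ([set l in J | r l j] :|: [set l in J | r j l]).
have DJ : D \subset J.
  by apply/subsetP => l; rewrite !inE => /orP[/eqP->//|/orP[]/andP[]].
have cD : #|D| <= 2 * k + 1.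
  rewrite cardsU1; have [cU _] := leq_card_setU [set l in J | r l j] [set l in J | r j l].
  have := outk _ jJ; case: (_ \notin _); lia.
have [||L [LJ cL] Lind] := IH (J :\: D).
- move=> l; rewrite inE => /andP[_ /outk]; apply: leq_trans; apply: subset_leq_card.
  by apply/subsetP => m; rewrite !inE => /andP[/andP[_ ->] ->].
- by rewrite cardsD (finset.setIidPr DJ); lia.
have LD l : l \in L -> l \notin D by move/(subsetP LJ); rewrite inE => /andP[].
exists (j |: L).
  split; last by rewrite cardsU1 cL (contraTN (LD j)) // !inE eqxx.
  rewrite finset.subUset sub1set jJ; apply: fintype.subset_trans LJ _.
  by apply/subsetP => l; rewrite inE => /andP[].
have LJ' l : l \in L -> l \in J by move/(subsetP LJ); rewrite inE => /andP[].
move=> u v; rewrite !inE => /orP[/eqP->|uL] /orP[/eqP->|vL]; rewrite ?eqxx // => uv.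
- by have := LD _ vL; rewrite !inE (LJ' _ vL) !negb_or => /and3P[].
- by have := LD _ uL; rewrite !inE (LJ' _ uL) !negb_or => /and3P[].
- exact: Lind.
Qed.

(** Branch sets grow from [h] to at most [h + (s + h - 1)] vertices, whence [2 * h + s - 1]. In the
    count, [s * d] pays for discarded sets; the rest exceeds the threshold of [stable_of_outdegree]
    for outdegree [d * (s + h - 1)]. *)
Lemma power_no_model (s t d h : nat) (G : sgraph) :
  0 < t -> 0 < h -> ~ has_model 1 (2 * h + s - 1) s t G ->
  ~ has_model 1 h s ((2 * d * (s + h - 1) + 1) * (t - 1) + 1 + s * d) (power d G).
Proof.
set t' := (_ + s * d) => t0 h0 noG.
case/has_model_vertex_model => x [Y [injx conY disY xY [adjxY cardY]]].
apply: noG.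
have /choice[M MP] j := power_branch (conY j) (adjxY^~ j) (cardY j).
(* If [x i] is a middle vertex, it has degree at most [d] and a neighbour in each of the disjoint
   [Y j] using it, so each [i] spoils at most [d] indices. *)
pose bad := \bigcup_i [set j | x i \in M j].
have cbad : #|bad| <= s * d.
  apply: leq_trans (card_bigcup_le _ _) _; rewrite -[s in leqRHS]card_ord -sum_nat_const.
  apply: leq_sum => i _.
  have [->|[j]] := set_0Vmem [set j | x i \in M j]; first by rewrite cards0.
  rewrite inE => xM; have [_ _ /(_ _ xM) [dx _] _] := MP j.
  apply: leq_trans dx; apply: (card_meeting_le disY) => l; rewrite inE => xMl.
  have [_ _ /(_ _ xMl) [_ [y yY xy]] _] := MP l.
  by exists y; rewrite ?inE.
pose Z j := Y j :|: M j.
pose r j l := (j != l) && [exists w in M j, w \in Z l].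
have outk j : j \in ~: bad -> #|[set l in ~: bad | r j l]| <= d * (s + h - 1).
  move=> _; have [cM _ mid _] := MP j.
  have sub : [set l in ~: bad | r j l] \subset
      \bigcup_(w in M j) [set l | (j != l) && (w \in Z l)].
    apply/subsetP => l; rewrite !inE => /andP[_ /andP[jl /exists_inP[w wM wZ]]].
    by apply/bigcupP; exists w; rewrite // inE jl.
  apply: leq_trans (subset_leq_card sub) _.
  apply: leq_trans (_ : \sum_(w in M j) d <= _); last first.
    by rewrite sum_nat_const mulnC leq_mul2l cM orbT.
  apply: leq_trans (card_bigcup_le _ _) _.
  apply: leq_sum => w wM; have [dw [y yY wy]] := mid _ wM.
  (* Each [l] in conflict through [w] has [w] or a neighbour of [w] in [Y l], but not [y], which
     lies in [Y j]. Dropping [y] offsets adding [w], so [#|W| <= d]. *)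
  pose W := (w |: [set z | adj w z]) :\ y.
  have cW : #|W| <= d.
    have : #|W|.+1 <= d.+1; last by [].
    have -> : #|W|.+1 = #|w |: [set z | adj w z]|.
      by rewrite [RHS](cardsD1 y) !inE wy orbT.
    by rewrite cardsU1 -[d.+1]add1n leq_add //; case: (_ \notin _).
  apply: leq_trans cW; apply: (card_meeting_le disY) => l; rewrite inE => /andP[jl].
  have yl z : z \in Y l -> z != y.
    move=> zY; apply/eqP => zy; have := disY _ _ jl; rewrite disjoint_subset.
    by move/subsetP/(_ _ yY); rewrite !inE -zy zY.
  rewrite inE => /orP[wY|wMl].
    by exists w => //; rewrite !inE eqxx /= andbT yl.
  have [_ _ /(_ _ wMl) [_ [z zY wz]] _] := MP l.
  by exists z => //; rewrite !inE wz orbT andbT yl.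
have cgood : (2 * (d * (s + h - 1)) + 1) * (t - 1) < #|~: bad|.
  have := cardsC bad; rewrite card_ord => E.
  have : t' <= s * d + #|~: bad| by rewrite -[leqLHS]E leq_add2r.
  move: #|~: bad| => g; rewrite /t' -mulnA; lia.
have [L [Lgood]] := stable_of_outdegree outk cgood.
rewrite subn1 prednK // => cL Lind.
pose e (k : 'I_t) := enum_val (cast_ord (esym cL) k).
have eL k : e k \in L by apply: enum_valP.
have inje : injective e by move=> k k' /enum_val_inj /cast_ord_inj.
apply: (@vertex_model_has_model (2 * h + s - 1) s t G x (fun k => Z (e k))).
split=> //.
- by move=> k; have [] := MP (e k).
- move=> k k' kk'; have nee : e k != e k' by rewrite (inj_eq inje).
  rewrite disjoint_subset; apply/subsetP => w; rewrite !inE => wk.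
  apply/negP => wk'.
  have := Lind _ _ (eL k) (eL k') nee; have := Lind _ _ (eL k') (eL k).
  rewrite eq_sym => /(_ nee); rewrite /r nee eq_sym nee /= => /exists_inPn n1 /exists_inPn n2.
  (* A common vertex that is a middle vertex of either set is a conflict; otherwise it lies in two
     disjoint original branch sets. *)
  case/orP: wk => [wY|wM]; last by have := n2 _ wM; rewrite !inE wk'.
  case/orP: (wk') => [wY'|wM']; last by have := n1 _ wM'; rewrite !inE wY.
  have := disY _ _ nee; rewrite disjoint_subset => /subsetP/(_ _ wY).
  by rewrite inE wY'.
- move=> i k; rewrite inE negb_or xY /=.
  have := subsetP Lgood _ (eL k); rewrite inE; apply: contra => xM.
  by apply/bigcupP; exists i; rewrite ?inE.
- split=> [i k|k]; first by have [_ _ _ /(_ i)] := MP (e k).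
  have [cM _ _ _] := MP (e k).
  apply: leq_trans (leq_card_setU _ _) _.
  by apply: leq_trans (leq_add (cardY (e k)) cM) _; clear -h0; lia.
Qed.

(** * Forests *)

(** Were all degrees inside [W] at least 2, a path in [W] could be prolonged at its head forever,
    since a neighbour already on the path would close a cycle. *)
Lemma forest_leaf (T : sgraph) (W : {set T}) :
  forest T -> W != set0 -> exists2 v, v \in W & #|[set y in W | adj v y]| <= 1.
Proof.
move=> fT /set0Pn[w wW]; apply: contrapT => noleaf.
have deg2 v : v \in W -> 1 < #|[set y in W | adj v y]|.
  by move=> vW; rewrite ltnNge; apply/negP => le; apply: noleaf; exists v.
have grow n : exists (x : T) (p : seq T),
    [/\ size p = n, path (@adj T) x p, uniq (x :: p) & {subset x :: p <= W}].
  elim: n => [|n [x [p [sp pp up pW]]]].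
    by exists w, [::]; split=> // x; rewrite inE => /eqP->.
  have xW : x \in W by apply: pW; rewrite inE eqxx.
  (* The neighbour must avoid the successor of [x] on the path; for empty [p] the default [x]
     excludes nothing, as [x] is not its own neighbour. *)
  have [y /andP[yW xy] yp] : exists2 y, (y \in W) && adj x y & y != head x p.
    have /card_gt1P[a [b [+ + ab]]] := deg2 x xW.
    rewrite !inE => aP bP.
    have [ah|ah] := eqVneq a (head x p); last by exists a.
    by exists b => //; rewrite -ah eq_sym.
  have [yxp|yxp] := boolP (y \in x :: p); last first.
    exists y, (x :: p); split=> //=; first by rewrite sp.
    - by rewrite adj_sym xy.
    - by rewrite yxp.
    - by move=> z; rewrite inE => /orP[/eqP->//|/pW].
  have yx : y != x by apply: contraTneq xy => ->; rewrite adj_irr.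
  move: yxp; rewrite inE (negPf yx) /= => ypp.
  case/path.splitP: ypp sp pp up pW yp => p1 p2 sp pp up pW yp.
  case: p1 => [|z p1] in sp pp up pW yp *; first by rewrite /= eqxx in yp.
  exfalso; apply: (fT (x :: rcons (z :: p1) y)) => //; first by rewrite /= size_rcons.
  rewrite /ucycle [cycle _ _]/= rcons_path last_rcons [adj y x]adj_sym xy andbT.
  move: pp up; rewrite cat_path -cat_cons cat_uniq => /andP[+ _] /andP[-> _].
  by rewrite /= => ->.
have [x [p [sp _ /card_uniqP ux _]]] := grow #|T|.
by have := max_card (mem (x :: p)); rewrite ux /= sp ltnn.
Qed.

(** Pairs are ordered, so [edge_weight W W] is twice the number of edges inside [W]. *)
Definition edge_weight (G : sgraph) (A B : {set G}) : nat :=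
  \sum_(x in A) \sum_(y in B) adj x y.

Lemma edge_weightC (G : sgraph) (A B : {set G}) :
  edge_weight A B = edge_weight B A.
Proof.
rewrite /edge_weight exchange_big; apply: eq_bigr => x _.
by apply: eq_bigr => y _; rewrite adj_sym.
Qed.

Lemma edge_weightUl (G : sgraph) (A A' B : {set G}) :
  [disjoint A & A'] -> edge_weight (A :|: A') B = edge_weight A B + edge_weight A' B.
Proof.
move=> dis; rewrite /edge_weight -bigU //.
by apply: eq_bigl => x; rewrite !inE.
Qed.

Lemma edge_weightUr (G : sgraph) (A B B' : {set G}) :
  [disjoint B & B'] -> edge_weight A (B :|: B') = edge_weight A B + edge_weight A B'.
Proof. by move=> dis; rewrite !(edge_weightC A) edge_weightUl. Qed.

Lemma edge_weight1 (G : sgraph) (v : G) (B : {set G}) :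
  edge_weight [set v] B = #|[set y in B | adj v y]|.
Proof. by rewrite /edge_weight big_set1 card_set_sum. Qed.

(** Deleting a leaf lowers the weight by at most 2 and the right side by exactly 2. This is the
    bound of [#|W| - 1] edges without truncated subtraction. *)
Lemma forest_edge_weight (T : sgraph) (W : {set T}) :
  forest T -> W != set0 -> edge_weight W W + 2 <= 2 * #|W|.
Proof.
move=> fT; have [n] := ubnP #|W|; elim: n W => // n IH W /ltnSE cW W0.
have [v vW dv] := forest_leaf fT W0.
have dvW' : edge_weight [set v] (W :\ v) <= 1.
  rewrite edge_weight1; apply: leq_trans dv; apply: subset_leq_card.
  by apply/subsetP => y; rewrite !inE => /andP[/andP[_ ->] ->].
have vv : edge_weight [set v] [set v] = 0.
  by rewrite /edge_weight !big_set1 adj_irr.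
have dis : [disjoint [set v] & W :\ v] by rewrite disjoints1 !inE eqxx.
have EW : edge_weight W W =
    edge_weight [set v] (W :\ v) + edge_weight [set v] (W :\ v) +
    edge_weight (W :\ v) (W :\ v).
  rewrite -{1 2}(setD1K vW) edge_weightUl // !edge_weightUr // vv add0n.
  by rewrite [edge_weight (W :\ v) [set v]]edge_weightC addnA.
have cWv := cardsD1 v W; rewrite vW in cWv.
have [W'0|W'0] := eqVneq (W :\ v) set0.
  move: EW; rewrite W'0 /edge_weight big_set0 big_set1 big_set0 => ->.
  by rewrite cWv; lia.
have := IH _ _ W'0; rewrite cWv in cW; move=> /(_ cW); lia.
Qed.

(* Count the edges inside Q and its outer neighbourhood N: the forest bound
   leaves room for them only if N is large. *)
Lemma forest_boundary (s : nat) (T : sgraph) (Q : {set T}) :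
  forest T -> 1 < s -> Q != set0 -> {in Q, forall v, s <= deg v} ->
  s <= #|[set z in ~: Q | [exists q in Q, adj q z]]|.
Proof.
move=> fT s1 Q0 degQ; set N := [set z in _ | _].
have dis : [disjoint Q & N].
  by rewrite disjoint_subset; apply/subsetP => x xQ; rewrite !inE xQ.
have QN0 : Q :|: N != set0 by apply: contra Q0; rewrite setU_eq0 => /andP[].
have := forest_edge_weight fT QN0.
rewrite edge_weightUl // !edge_weightUr // [edge_weight N Q]edge_weightC.
have := forest_edge_weight fT Q0.
have -> : #|Q :|: N| = #|Q| + #|N|.
  by rewrite cardsU (_ : Q :&: N = set0) ?cards0 ?subn0 //; apply/eqP; rewrite setI_eq0.
have : s * #|Q| <= edge_weight Q Q + edge_weight Q N.
  rewrite -edge_weightUr // mulnC -sum_nat_const; apply: leq_sum => x xQ.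
  apply: leq_trans (degQ x xQ) _; rewrite /deg -sum1_card big_mkcond /=.
  rewrite [leqRHS]big_mkcond; apply: leq_sum => y _; rewrite inE.
  case: ifP => // xy; rewrite !inE; case: (y \in Q) => //=.
  by rewrite (_ : [exists _ in _, _]) //; apply/exists_inP; exists x.
(* The three inequalities combine to [(s - 2) * #|Q| + 2 <= #|N|], whose left side is at least [s]
   as [Q] is nonempty. *)
have := Q0; rewrite -card_gt0; nia.
Qed.

(** Leaves are removed one by one: the parent of a leaf is its only remaining neighbour, if any, and
    a vertex removed earlier gets a higher rank [r]. *)
Lemma forest_parent (T : sgraph) (W : {set T}) :
  forest T -> exists (par : T -> option T) (r : T -> nat),
    (forall x y, x \in W -> y \in W -> adj x y -> par x = Some y \/ par y = Some x) /\
    (forall x y, x \in W -> par x = Some y -> [/\ y \in W, adj x y & r y < r x]).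
Proof.
move=> fT; have [n] := ubnP #|W|; elim: n W => // n IH W /ltnSE cW.
have [->|W0] := eqVneq W set0.
  by exists (fun=> None), (fun=> 0); split=> x y; rewrite inE.
have [v vW dv] := forest_leaf fT W0.
have [|par [r [par1 par2]]] := IH (W :\ v).
  by move: cW; rewrite (cardsD1 v W) vW.
pose par' x := if x == v then [pick y in W | adj v y] else par x.
pose r' x := if x == v then (\max_(y : T) r y).+1 else r x.
exists par', r'; split=> x y.
  have par'v z : z \in W -> adj v z -> par' v = Some z.
    move=> zW vz; rewrite /par' eqxx; case: pickP => [u /andP[uW vu]|/(_ z)].
      by move/card_le1_eqP: dv => dv; rewrite (dv z u) ?inE ?zW ?uW.
    by rewrite zW vz.
  move=> xW yW xy; have [xv|xv] := eqVneq x v.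
    by left; rewrite xv in xy *; apply: par'v.
  have [yv|yv] := eqVneq y v.
    by right; rewrite yv adj_sym in xy *; apply: par'v.
  by rewrite /par' (negPf xv) (negPf yv); apply: par1; rewrite ?inE ?xv ?yv.
move=> xW; rewrite /par' /r'; have [->|xv] := eqVneq x v.
  case: pickP => // z /andP[zW vz] [<-]; split=> //.
  case: (eqVneq z v) => [zv|_]; first by rewrite zv adj_irr in vz.
  by rewrite ltnS; apply: leq_bigmax.
case/par2; first by rewrite !inE xv.
by rewrite !inE => /andP[yv ->] -> ryx; rewrite (negPf yv).
Qed.

(** * The upper bound *)

(* Sunflower lemma for functions: F' has core K' and, off the core, its
   members take pairwise disjoint sets of values. *)
Lemma function_sunflower (A V : finType) (k : nat) (F : {set {ffun A -> V}})
    (K : {set A}) :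
  {in F &, forall f g : {ffun A -> V}, {in K, f =1 g}} ->
  (k * #|A| * #|A|).+1 ^ #|~: K| < #|F| ->
  exists (K' : {set A}) (F' : {set {ffun A -> V}}),
    [/\ K \subset K', K' != setT & F' \subset F] /\
    [/\ k <= #|F'|, {in F' &, forall f g : {ffun A -> V}, {in K', f =1 g}} &
        {in F' &, forall f g : {ffun A -> V}, f != g ->
          {in ~: K' &, forall a b, f a != g b}}].
Proof.
(* Fixing one further argument costs a factor below [c]: at most [#|A|] arguments and [k * #|A|]
   values compete. *)
set c := (_ * _ * _).+1.
have [m] := ubnP #|~: K|; elim: m K F => // m IH K F /ltnSE cK agree big.
have KT : K != setT.
  apply: contraTneq big => KT; rewrite KT setCT cards0 expn0 -leqNgt.
  apply/card_le1_eqP => f g fF gF; apply/ffunP => a; apply: agree => //.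
  by rewrite KT inE.
(* Take a maximal subfamily without collisions off [K]. Either it has [k] members and [K] is the
   core, or every member of [F] takes one of its few values off [K], and the core grows by an
   argument at which one such value is frequent. *)
pose P (F' : {set {ffun A -> V}}) := (F' \subset F) &&
  [forall f in F', forall g in F', (f != g) ==>
    [forall a in ~: K, forall b in ~: K, f a != g b]].
have P0 : P set0.
  by rewrite /P finset.sub0set; apply/forall_inP => f; rewrite inE.
have [F' /maxsetP[/andP[F'F /forall_inP F'dis] F'max]] : {F' | maxset P F'}.
  by apply: ex_maxset; exists set0.
have dis : {in F' &, forall f g : {ffun A -> V}, f != g -> {in ~: K &, forall a b, f a != g b}}.
  move=> f g fF gF fg a b aK bK.
  by have /forall_inP/(_ _ gF)/implyP/(_ fg)/forall_inP/(_ _ aK)/forall_inP := F'dis _ fF; apply.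
have [kF'|F'k] := leqP k #|F'|.
  exists K, F'; split; split=> // f g fF gF; apply: agree.
    exact: (subsetP F'F).
  exact: (subsetP F'F).
pose B := \bigcup_(f in F') f @: ~: K.
have cB : #|B| <= k * #|A|.
  apply: leq_trans (card_bigcup_le _ _) _.
  apply: leq_trans (_ : \sum_(f in F') #|A| <= _).
    by apply: leq_sum => f _; apply: leq_trans (leq_imset_card _ _) (max_card _).
  by rewrite sum_nat_const leq_mul2r (ltnW F'k) orbT.
have [a0 a0K] : exists a, a \in ~: K.
  apply/set0Pn; apply: contra KT => /eqP KC.
  by rewrite -[K]setCK KC setC0.
have hit f : f \in F -> exists a b, [/\ a \in ~: K, b \in B & f a = b].
  move=> fF; have [fF'|fF'] := boolP (f \in F').
    exists a0, (f a0); split=> //; apply/bigcupP; exists f => //.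
    exact: imset_f.
  apply: contrapT => nohit; have : P (f |: F').
    have nohit' a g b : a \in ~: K -> g \in F' -> b \in ~: K -> f a != g b.
      move=> aK gF' bK; apply/eqP => fg; apply: nohit; exists a, (f a); split=> //.
      by apply/bigcupP; exists g; rewrite // fg imset_f.
    apply/andP; split; first by rewrite finset.subUset sub1set fF.
    apply/forall_inP => g gF; apply/forall_inP => g' gF'; apply/implyP => gg'.
    apply/forall_inP => a aK; apply/forall_inP => b bK.
    move: gF gF' gg'; rewrite !inE => /orP[/eqP->|gF] /orP[/eqP->|gF'] gg'.
    - by rewrite eqxx in gg'.
    - exact: nohit'.
    - by rewrite eq_sym; apply: nohit'.
    - exact: dis.
  move/F'max => /(_ (subsetUr _ _)) E.
  by rewrite -E !inE eqxx in fF'.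
pose Fab a b := [set f in F | f a == b].
have [a [b [aK bB cab]]] : exists a b,
    [/\ a \in ~: K, b \in B & c ^ #|~: K|.-1 < #|Fab a b|].
  apply: contrapT => no.
  have sub : F \subset \bigcup_(a in ~: K) \bigcup_(b in B) Fab a b.
    apply/subsetP => f fF; have [a [b [aK bB fab]]] := hit f fF.
    apply/bigcupP; exists a => //; apply/bigcupP; exists b => //.
    by rewrite inE fF fab /=.
  have := leq_trans big (subset_leq_card sub).
  rewrite ltnNge => /negP; apply; apply: leq_trans (card_bigcup_le _ _) _.
  apply: leq_trans (_ : \sum_(a in ~: K) \sum_(b in B) c ^ #|~: K|.-1 <= _).
    apply: leq_sum => a aK; apply: leq_trans (card_bigcup_le _ _) _.
    apply: leq_sum => b bB; rewrite leqNgt; apply/negP => lt; apply: no.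
    by exists a, b.
  rewrite !sum_nat_const.
  have -> : c ^ #|~: K| = c * c ^ #|~: K|.-1.
    by rewrite -expnS prednK //; apply/card_gt0P; exists a0.
  rewrite mulnA leq_mul2r; apply/orP; right.
  by have := max_card (~: K); rewrite /c; nia.
have cKa : #|~: K| = #|~: (a |: K)|.+1.
  rewrite (cardsD1 a) aK add1n; congr _.+1; apply: eq_card => x.
  by rewrite !inE negb_or.
have [|||K' [F'' [[aKK' K'T F''F] F''P]]] := IH (a |: K) (Fab a b).
- by rewrite -cKa.
- move=> f g; rewrite !inE => /andP[fF /eqP fa] /andP[gF /eqP ga] x.
  by rewrite !inE => /orP[/eqP->|xK]; rewrite ?fa ?ga //; apply: agree.
- by move: cab; rewrite cKa.
exists K', F''; split=> //; split=> //.
  by apply: fintype.subset_trans aKK'; apply: subsetUr.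
by apply: fintype.subset_trans F''F _; apply/subsetP => f; rewrite inE => /andP[].
Qed.

(** * Embeddings that agree on the low-degree vertices *)

Definition embedding (T G : sgraph) (f : T -> G) : Prop :=
  injective f /\ forall x y, adj x y -> adj (f x) (f y).

Lemma connset_embedding (T G : sgraph) (f : T -> G) (Q : {set T}) :
  embedding f -> connset Q -> connset (f @: Q).
Proof.
case=> injf homf [/set0Pn[q qQ] cut]; split; first by apply/set0Pn; exists (f q); apply: imset_f.
move=> B BQ /set0Pn[b bB] BneQ; pose B' := [set x in Q | f x \in B].
have B'Q : B' \subset Q by apply/subsetP => x; rewrite inE => /andP[].
have BE : B = f @: B'.
  apply/setP => y; apply/idP/imsetP => [yB|[x]]; last by rewrite inE => /andP[_ ?] ->.
  have /imsetP[x xQ yx] := subsetP BQ _ yB.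
  by exists x; rewrite // inE xQ -yx.
have [||x [y [xB']]] := cut B' B'Q.
- apply/set0Pn; move: bB; rewrite BE => /imsetP[x xB' _]; by exists x.
- by apply: contra BneQ => /eqP B'E; rewrite BE B'E.
rewrite inE => /andP[yB' yQ] xy; exists (f x), (f y); split; last exact: homf.
  by rewrite BE imset_f.
by rewrite inE imset_f // andbT BE mem_imset.
Qed.

(** A minimal nonempty subset of [R] closed under adjacency in [R] is connected, since a cut without
    crossing edges would be a smaller closed set. *)
Lemma component_exists (G : sgraph) (R : {set G}) :
  R != set0 -> exists Q : {set G}, [/\ Q \subset R, connset Q &
    forall q z, q \in Q -> z \in R -> adj q z -> z \in Q].
Proof.
move=> R0.
pose P (Q : {set G}) := [&& Q != set0, Q \subset R &
  [forall q in Q, forall z in R, adj q z ==> (z \in Q)]].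
have PR : P R.
  by rewrite /P R0 fintype.subxx; apply/forall_inP => q _; apply/forall_inP => z ->; rewrite implybT.
have [Q /minsetP[/and3P[Q0 QR /forall_inP clQ] Qmin]] : {Q | minset P Q}.
  by apply: ex_minset; exists R.
have cl q z : q \in Q -> z \in R -> adj q z -> z \in Q.
  by move=> qQ zR; have /forall_inP/(_ _ zR)/implyP := clQ _ qQ.
exists Q; split=> //; split=> // B BQ B0 BneQ; apply: contrapT => noedge.
have : P B.
  rewrite /P B0 (fintype.subset_trans BQ QR) /=.
  apply/forall_inP => q qB; apply/forall_inP => z zR; apply/implyP => qz.
  apply: contrapT => /negP zB; apply: noedge; exists q, z; split=> //.
  by rewrite inE zB (cl q) // (subsetP BQ).
by move/Qmin => /(_ BQ) BE; rewrite BE eqxx in BneQ.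
Qed.

Lemma embedding_fibre (s k h : nat) (T G : sgraph) (F : {set {ffun T -> G}}) :
  forest T -> #|T| = h -> 0 < s -> 1 < s \/ edges T = set0 ->
  0 < k ->
  ~ has_model 1 h s k G -> {in F, forall f : {ffun T -> G}, embedding f} ->
  {in F &, forall f g : {ffun T -> G}, {in [set v : T | deg v <= s - 1], f =1 g}} ->
  #|F| <= (k * h * h).+1 ^ h.
Proof.
move=> fT <- s0 sT k0 noM embF agree; rewrite leqNgt; apply/negP => big.
set L := [set v | _] in agree.
have [|K [F' [[LK KT F'F] [cF' agree' dis]]]] := @function_sunflower _ _ k F L agree.
  by apply: leq_trans big; rewrite ltnS leq_pexp2l // max_card.
have R0 : ~: K != set0 by apply: contra KT => /eqP KC; rewrite -[K]setCK KC setC0.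
have [Q [QR conQ clQ]] := component_exists R0.
have Q0 : Q != set0 by case: conQ.
have QK q : q \in Q -> q \notin K by move/(subsetP QR); rewrite inE.
have degQ : {in Q, forall v, s <= deg v}.
  move=> v /QK vK; have : v \notin L by apply: contra vK => /(subsetP LK).
  by rewrite inE; lia.
(* In an edgeless forest no vertex has degree at least [s], so [Q] could not exist; the other
   alternative is the bound that [forest_boundary] requires. *)
have s1 : 1 < s.
  case: sT => // E0; have [q qQ] := set0Pn _ Q0.
  have : 0 < deg q by apply: leq_trans s0 (degQ q qQ).
  by case/card_gt0P => y; rewrite inE -adjacent_in_edges E0 inE.
set N := [set z in ~: Q | [exists q in Q, adj q z]].
have cN : s <= #|N| by apply: forest_boundary.
pose f (j : 'I_k) : {ffun T -> G} := enum_val (widen_ord cF' j).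
have fF' j : f j \in F' by apply: enum_valP.
have embf j : embedding (f j) by apply: embF; apply: (subsetP F'F).
have injf : injective f by move=> j j' /enum_val_inj/(congr1 val) /= jj'; apply: val_inj.
pose z (i : 'I_s) : T := enum_val (widen_ord cN i).
have zN i : z i \in N by apply: enum_valP.
have injz : injective z by move=> i i' /enum_val_inj/(congr1 val) /= ii'; apply: val_inj.
(* Neighbours outside the component [Q] belong to the core, so all [f j] send them to the same
   vertices. *)
have zK i : z i \in K.
  have := zN i; rewrite !inE => /andP[zQ /exists_inP[q qQ qz]].
  by apply: contraNT zQ => zK; apply: clQ qz => //; rewrite inE.
pose j0 := Ordinal k0.
have fz i j : f j0 (z i) = f j (z i) by apply: agree'.
apply: noM; apply: (@vertex_model_has_model #|T| s k G (fun i => f j0 (z i)) (fun j => f j @: Q)).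
split.
- by move=> i i' /(embf j0).1 /injz.
- by move=> j; apply: connset_embedding.
- move=> j j' jj'; rewrite disjoint_subset; apply/subsetP => _ /imsetP[a aQ ->].
  rewrite inE; apply/imsetP => -[b bQ ab].
  have := dis _ _ (fF' j) (fF' j'); rewrite (inj_eq injf) => /(_ jj' a b).
  by rewrite !inE !QK // ab eqxx => /(_ isT isT).
- move=> i j; rewrite (fz i j) (mem_imset _ _ (embf j).1).
  by have := zN i; rewrite !inE => /andP[].
- split=> [i j|j]; last by apply: leq_trans (leq_imset_card _ _) (max_card _).
  have := zN i; rewrite !inE => /andP[_ /exists_inP[q qQ qz]].
  exists (f j q); first exact: imset_f.
  by rewrite (fz i j); apply: (embf j).2; rewrite adj_sym.
Qed.

(** * Placements of the low-degree vertices *)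

Lemma stable_le_alpha (m : nat) (T : sgraph) (S : {set T}) :
  stable S -> S \subset [set v : T | deg v <= m] -> #|S| <= alpha m T.
Proof.
move=> stS SL; set L := [set v | _] in SL.
pose S' : {set induced L} := [set u | val u \in S].
have <- : #|S'| = #|S|.
  rewrite -(card_imset _ val_inj); apply: eq_card => x; apply/imsetP/idP.
    by case=> u; rewrite inE => uS ->.
  by move=> xS; exists (exist _ x (subsetP SL _ xS)); rewrite ?inE.
apply: (@leq_bigmax_cond _ (@stable (induced L)) (fun S : {set induced L} => #|S|)).
apply/forall_inP => u; rewrite inE => uS; apply/forall_inP => v; rewrite inE => vS.
by have /forall_inP/(_ _ uS)/forall_inP/(_ _ vS) := stS.
Qed.

Lemma alpha_attained (m : nat) (T : sgraph) :
  exists S : {set T}, [/\ stable S, S \subset [set v : T | deg v <= m] & #|S| = alpha m T].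
Proof.
set L := [set v | _].
have st0 : @stable (induced L) set0 by apply/forall_inP => u; rewrite inE.
pose A := [arg max_(A > set0 :> {set induced L} | stable A) #|A|].
have [stA eA] : stable A /\ #|A| = alpha m T.
  rewrite /alpha /stability_number (bigop.bigmax_eq_arg set0) // -/L.
  by split=> //; rewrite /A; case: arg_maxnP.
exists [set val u | u in A]; split.
- apply/forall_inP => _ /imsetP[u uA ->]; apply/forall_inP => _ /imsetP[v vA ->].
  by have /forall_inP/(_ _ uA)/forall_inP/(_ _ vA) := stA.
- by apply/subsetP => _ /imsetP[u _ ->]; apply: (valP u).
- by rewrite card_imset //; apply: val_inj.
Qed.

Definition restriction (A V : finType) (W : {set A}) (f : {ffun A -> V}) :
    {ffun A -> option V} :=
  [ffun x => if x \in W then Some (f x) else None].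

(** One peeling step: the placement on [W] is recovered from that on [W'] and a datum [b f] with at
    most [c] values. *)
Lemma card_restriction_step (A V B : finType) (E : {set {ffun A -> V}})
    (W W' : {set A}) (b : {ffun A -> V} -> B) (D : {set B})
    (glue : {ffun A -> option V} -> B -> {ffun A -> option V}) (c m : nat) :
  {in E, forall f, b f \in D /\ restriction W f = glue (restriction W' f) (b f)} ->
  #|D| <= c -> #|restriction W' @: E| <= c ^ m -> #|restriction W @: E| <= c ^ m.+1.
Proof.
move=> bP cD cW'.
apply: leq_trans (_ : #|[set glue p.1 p.2 | p in finset.setX (restriction W' @: E) D]| <= _).
  apply: subset_leq_card; apply/subsetP => _ /imsetP[f fE ->].
  have [bD ->] := bP f fE; apply/imsetP; exists (restriction W' f, b f) => //.
  by rewrite inE /= imset_f.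
apply: leq_trans (leq_imset_card _ _) _.
by rewrite cardsX expnSr leq_mul.
Qed.

(* Peel off a leaf of T[W] together with its neighbour, if any: a placement of
   the pair is an edge of G, and the leaf enlarges the stable set. *)
Lemma card_restriction_forest (T G : sgraph) (c : nat) (E : {set {ffun T -> G}})
    (W : {set T}) :
  forest T -> {in E, forall f : {ffun T -> G}, embedding f} ->
  #|G| <= c -> #|[set p : G * G | adj p.1 p.2]| <= c ->
  exists S : {set T}, [/\ S \subset W, stable S & #|restriction W @: E| <= c ^ #|S|].
Proof.
move=> fT embE cV cP; have [n] := ubnP #|W|; elim: n W => // n IH W /ltnSE cW.
have [->|W0] := eqVneq W set0.
  exists set0; split=> //; first by apply/forall_inP => u; rewrite inE.
  rewrite cards0 expn0; apply/card_le1_eqP => _ _ /imsetP[f _ ->] /imsetP[g _ ->].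
  by apply/ffunP => x; rewrite !ffunE inE.
have [v vW dv] := forest_leaf fT W0.
(* When [W'] contains neither [v] nor a neighbour of [v], the stable set found in [W'] can be
   enlarged by [v], which pays for one more factor [c]. *)
have extend (W' : {set T}) : W' \subset W -> v \notin W' ->
    (forall y, y \in W' -> ~~ adj v y) ->
    (forall S : {set T}, #|restriction W' @: E| <= c ^ #|S| ->
       #|restriction W @: E| <= c ^ #|S|.+1) ->
    exists S : {set T}, [/\ S \subset W, stable S & #|restriction W @: E| <= c ^ #|S|].
  move=> W'W vW' nadj step.
  have [|S [SW' stS cS]] := IH W'.
    apply: leq_trans cW; apply: proper_card; rewrite properE W'W.
    by apply/subsetPn; exists v.
  have vS : v \notin S by apply: contra vW' => /(subsetP SW').
  exists (v |: S); split.
  - by rewrite finset.subUset sub1set vW (fintype.subset_trans SW').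
  - apply/forall_inP => x; rewrite !inE => xS; apply/forall_inP => y; rewrite !inE => yS.
    case/orP: xS => [/eqP->|xS]; case/orP: yS => [/eqP->|yS]; rewrite ?adj_irr //.
    + by apply: nadj; apply: (subsetP SW').
    + by rewrite adj_sym; apply: nadj; apply: (subsetP SW').
    + by have /forall_inP/(_ _ xS)/forall_inP/(_ _ yS) := stS.
  - by rewrite cardsU1 vS add1n; apply: step.
have [N0|[u]] := set_0Vmem [set y in W | adj v y].
  apply: (extend (W :\ v)); rewrite ?subD1set //.
  - by rewrite !inE eqxx.
  - move=> y; rewrite !inE => /andP[_ yW]; apply/negP => vy.
    by have := finset.in_set0 y; rewrite -N0 inE yW vy.
  - move=> S; apply: (card_restriction_step (b := fun f => f v) (D := setT)
      (glue := fun r b => [ffun x => if x == v then Some b else r x])).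
      move=> f _; split; rewrite ?inE //; apply/ffunP => x; rewrite !ffunE !inE.
      by case: eqP => [->|]; rewrite ?vW.
    by rewrite cardsT.
rewrite inE => /andP[uW vu].
apply: (extend (W :\: [set u; v])); rewrite ?finset.subsetDl //.
- by rewrite !inE eqxx orbT.
- move=> y; rewrite !inE negb_or -andbA => /and3P[yu _ yW]; apply: contra yu => vy.
  by have /card_le1_eqP dvP := dv; rewrite (dvP y u) ?inE ?yW ?uW.
- move=> S; apply: (card_restriction_step (b := fun f => (f v, f u))
    (D := [set p : G * G | adj p.1 p.2])
    (glue := fun r b => [ffun x => if x == v then Some b.1
                                   else if x == u then Some b.2 else r x])).
    move=> f fE; split; first by rewrite inE; apply: (embE f fE).2.
    apply/ffunP => x; rewrite !ffunE !inE.
    by case: (eqVneq x v) => [->|]; rewrite ?vW //; case: (eqVneq x u) => [->|]; rewrite ?uW.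
  exact: cP.
Qed.

Lemma card_le_fibres (A B : finType) (f : A -> B) (E : {set A}) (m : nat) :
  (forall b, #|[set x in E | f x == b]| <= m) -> #|E| <= #|f @: E| * m.
Proof.
move=> fib; rewrite -sum1_card (partition_big f (mem (f @: E))) /=; last first.
  by move=> x xE; apply: imset_f.
rewrite -sum_nat_const; apply: leq_sum => b _.
by apply: leq_trans (fib b); rewrite -sum1_card; apply: eq_leq; apply: eq_bigl => x; rewrite inE.
Qed.

Definition embeddings (T G : sgraph) : {set {ffun T -> G}} :=
  [set f : {ffun T -> G} | `[< embedding f >]].

(** Peeling bounds the placements of the low-degree vertices, and the sunflower argument bounds the
    extensions of each placement. *)
Lemma card_embeddings_le (s k c h : nat) (T G : sgraph) :
  forest T -> #|T| = h -> 0 < s -> 1 < s \/ edges T = set0 -> 0 < k -> 0 < c ->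
  ~ has_model 1 h s k G -> #|G| <= c -> #|[set p : G * G | adj p.1 p.2]| <= c ->
  #|embeddings T G| <= c ^ alpha (s - 1) T * (k * h * h).+1 ^ h.
Proof.
move=> fT hT s0 sT k0 c0 noM cV cP; set L := [set v : T | deg v <= s - 1].
have embE : {in embeddings T G, forall f : {ffun T -> G}, embedding f}.
  by move=> f; rewrite inE => /asboolP.
have [S [SL stS cS]] := card_restriction_forest L fT embE cV cP.
apply: leq_trans (_ : #|restriction L @: embeddings T G| * (k * h * h).+1 ^ h <= _).
  apply: card_le_fibres => r; apply: (embedding_fibre fT hT s0 sT k0 noM).
    by move=> f; rewrite inE => /andP[/embE].
  move=> f g; rewrite !inE => /andP[_ /eqP fr] /andP[_ /eqP gr] v vL.
  have := congr1 (fun u : {ffun T -> option G} => u v) (etrans fr (esym gr)).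
  by rewrite !ffunE vL => -[].
rewrite leq_mul2r; apply/orP; right; apply: leq_trans cS _.
by rewrite leq_pexp2l // stable_le_alpha.
Qed.

(** * Copies versus embeddings *)

Lemma copy_embedding (T G : sgraph) (S : subgraph G) :
  isomorphic T (graph_of_subgraph S) -> exists f : {ffun T -> G},
    [/\ embedding f, f @: [set: T] = (val S).1 & [set f @: e | e : {set T} in edges T] = (val S).2].
Proof.
case=> g [g' gK g'K] gadj.
exists [ffun x => val (g x)]; split.
- split=> [x y|x y]; rewrite !ffunE; first by move/val_inj/(can_inj gK).
  rewrite -gadj -[adj (val _) (val _)]adjacent_in_edges; have /andP[/subsetP sE _] := valP S.
  exact: sE.
- apply/setP => y; apply/imsetP/idP => [[x _ ->]|yS]; first by rewrite ffunE; apply: (valP (g x)).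
  by exists (g' (exist _ y yS)); rewrite ?inE // ffunE g'K.
- apply/setP => e; apply/imsetP/idP => [[_ /imsetP[[x y] + ->] ->]|eS].
    by rewrite inE /= -gadj /= imsetU1 imset_set1 !ffunE.
  have /andP[/subsetP /(_ _ eS) /imsetP[[x y]]] := valP S.
  rewrite inE /= => xy E /forall_inP/(_ _ eS)/subsetP sub.
  have xS : x \in (val S).1 by apply: sub; rewrite E !inE eqxx.
  have yS : y \in (val S).1 by apply: sub; rewrite E !inE eqxx orbT.
  exists [set g' (exist _ x xS); g' (exist _ y yS)].
    by rewrite adjacent_in_edges -gadj !g'K /= /sub_adj /= -E.
  by rewrite imsetU1 imset_set1 !ffunE !g'K.
Qed.

Lemma copies_le_embeddings (T G : sgraph) : copies T G <= #|embeddings T G|.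
Proof.
rewrite /copies -(card_imset _ (@val_inj _ _ _)).
apply: leq_trans (leq_imset_card (fun f : {ffun T -> G} =>
  (f @: [set: T], [set f @: e | e : {set T} in edges T])) _).
apply: subset_leq_card; apply/subsetP => _ /imsetP[S + ->].
rewrite inE => /asboolP /copy_embedding[f [ef fV fE]].
apply/imsetP; exists f; first by rewrite inE; apply/asboolP.
by rewrite fV fE -surjective_pairing.
Qed.

Lemma embedding_copy (T G : sgraph) (f : T -> G) :
  embedding f -> exists2 S : subgraph G,
    isomorphic T (graph_of_subgraph S) & sub_vertices S = f @: [set: T].
Proof.
case=> injf homf.
pose P : {set G} * {set {set G}} := (f @: [set: T], [set f @: e | e : {set T} in edges T]).
have PP : (P.2 \subset edges G) && [forall e in P.2, e \subset P.1].
  apply/andP; split.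
    apply/subsetP => _ /imsetP[_ /imsetP[[x y] + ->] ->]; rewrite inE /= => xy.
    by rewrite imsetU1 imset_set1 adjacent_in_edges homf.
  by apply/forall_inP => _ /imsetP[e _ ->]; apply: imsetS; apply: finset.subsetT.
exists (exist _ P PP) => //.
have fP x : f x \in P.1 by apply: imset_f; rewrite inE.
exists (fun x => exist _ (f x) (fP x)).
  apply: inj_card_bij; first by move=> x y /(congr1 val) /= /injf.
  by rewrite card_sig (eq_card (B := mem (f @: [set: T]))) // card_imset // cardsT.
move=> x y; rewrite -[RHS]adjacent_in_edges /= /sub_adj /=.
have -> : [set f x; f y] = f @: [set x; y] by rewrite imsetU1 imset_set1.
by rewrite mem_imset //; apply: imset_inj.
Qed.

(** Telling copies apart by their vertex sets avoids dividing by the automorphisms of [T]. *)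
Lemma card_le_copies (T G : sgraph) (I : finType) (F : {set I}) (f : I -> T -> G) :
  {in F, forall i, embedding (f i)} ->
  {in F &, injective (fun i => f i @: [set: T])} -> #|F| <= copies T G.
Proof.
move=> emb inj; rewrite -(card_in_imset inj) /copies.
apply: leq_trans (leq_imset_card (@sub_vertices G) _).
apply: subset_leq_card; apply/subsetP => _ /imsetP[i /emb/embedding_copy[S iso VS] ->].
by apply/imsetP; exists S; rewrite ?VS // inE; apply/asboolP.
Qed.

Lemma card_adjacent_pairs (G : sgraph) :
  #|[set p : G * G | adj p.1 p.2]| <= 4 * #|edges G|.
Proof.
pose e (p : G * G) := [set p.1; p.2]; rewrite mulnC.
apply: (@leq_trans (#|e @: [set p : G * G | adj p.1 p.2]| * 4)); last first.
  by rewrite leq_mul2r; apply/orP; right.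
apply: card_le_fibres => b.
have [->|[[x y]]] := set_0Vmem [set p in [set p : G * G | adj p.1 p.2] | e p == b].
  by rewrite cards0.
rewrite !inE => /andP[_ /eqP <-].
apply: leq_trans (_ : #|finset.setX (e (x, y)) (e (x, y))| <= _).
  apply: subset_leq_card; apply/subsetP => -[u v]; rewrite inE => /andP[_ /eqP E].
  by rewrite finset.in_setX -E !inE /= !eqxx orbT.
rewrite cardsX /= cards2; by case: (_ != _).
Qed.

(** A vertex of degree at most [d] adds at most [d * d] ordered pairs, so the number of edges stays
    linear if it is so in [G]. *)
Lemma card_power_pairs (d : nat) (G : sgraph) :
  #|[set p : power d G * power d G | adj p.1 p.2]| <= 4 * #|edges G| + d * d * #|G|.
Proof.
pose N (v : G) := finset.setX [set x | adj v x] [set x | adj v x].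
apply: (@leq_trans #|[set p : G * G | adj p.1 p.2] :|: \bigcup_(v | deg v <= d) N v|).
  apply: subset_leq_card; apply/subsetP => -[x y]; rewrite !inE /= => /power_adjP.
  case=> [->//|[w [dw wx wy]]]; apply/orP; right; apply/bigcupP; exists w => //.
  by rewrite !inE wx wy.
apply: leq_trans (leq_card_setU _ _) _; apply: leq_add; first exact: card_adjacent_pairs.
apply: leq_trans (card_bigcup_le _ _) _.
apply: leq_trans (_ : \sum_(v : G | deg v <= d) d * d <= _).
  by apply: leq_sum => v dv; rewrite cardsX leq_mul.
by rewrite sum_nat_const mulnC leq_mul2l max_card orbT.
Qed.

Lemma copies_power_le (s k c d h : nat) (T G : sgraph) :
  forest T -> #|T| = h -> 0 < s -> 1 < s \/ edges T = set0 -> 0 < k ->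
  ~ has_model 1 h s k (power d G) -> #|edges G| <= c * #|G| -> 0 < #|G| ->
  copies T (power d G) <=
    ((4 * c + d * d).+1 * #|G|) ^ alpha (s - 1) T * (k * h * h).+1 ^ h.
Proof.
move=> fT hT s0 sT k0 noM cE G0; apply: leq_trans (copies_le_embeddings _ _) _.
apply: card_embeddings_le => //.
- by rewrite muln_gt0 G0.
- by rewrite leq_pmull.
- by apply: leq_trans (card_power_pairs d G) _; nia.
Qed.

(** * The lower bound *)

(** The root will be a fixed point of [p]; [x != y] suppresses the loop there. *)
Definition parent_adj (A : finType) (p : A -> A) : rel A :=
  fun x y => (x != y) && ((p x == y) || (p y == x)).

Lemma parent_adj_sym (A : finType) (p : A -> A) : symmetric (parent_adj p).
Proof. by move=> x y; rewrite /parent_adj eq_sym orbC. Qed.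

Lemma parent_adj_irr (A : finType) (p : A -> A) : irreflexive (parent_adj p).
Proof. by move=> x; rewrite /parent_adj eqxx. Qed.

Definition parent_graph (A : finType) (p : A -> A) : sgraph :=
  SGraph (parent_adj_sym p) (parent_adj_irr p).

(** Following [p] lowers [r] and so reaches the root. On a cycle, both neighbours of a vertex of
    largest rank would be its parent. *)
Lemma parent_graph_tree (A : finType) (p : A -> A) (r : A -> nat) (root : A) :
  p root = root -> (forall a, a != root -> r (p a) < r a) -> tree (parent_graph p).
Proof.
move=> proot rp; split.
  split; first by apply/card_gt0P; exists root.
  have csym : connect_sym (@adj (parent_graph p)).
    exact: (sym_connect_sym (@parent_adj_sym _ p)).
  suff toroot x : connect (@adj (parent_graph p)) x root.
    by move=> x y; apply: connect_trans (toroot x) _; rewrite csym.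
  have [n] := ubnP (r x); elim: n x => // n IH x /ltnSE rx.
  have [->|xroot] := eqVneq x root; first exact: connect0.
  have rpx := rp x xroot.
  apply: connect_trans (IH (p x) (leq_trans rpx rx)); apply: connect1.
  rewrite /= /parent_adj eqxx andbT.
  by apply: contraTneq rpx => <-; rewrite ltnn.
move=> c c2 /andP[cyc uc].
have [x0 x0c] : exists x, x \in c by case: c c2 {cyc uc} => // x c _; exists x; rewrite inE eqxx.
pose x := [arg max_(x > x0 in c) r x].
have [xc xmax] : x \in c /\ forall y, y \in c -> r y <= r x.
  by rewrite /x; case: arg_maxnP.
have toparent y : y \in c -> parent_adj p x y -> y = p x.
  move=> yc /andP[xy /orP[/eqP->//|/eqP py]].
  have yroot : y != root by apply: contraNneq xy => yr; rewrite -py yr proot.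
  by have := rp y yroot; rewrite py ltnNge xmax.
have [i s' E] := rot_to xc.
have := c2; have := cyc; have := uc.
rewrite -(rot_uniq i) -(rot_cycle i) -(size_rot i) E.
have s'c y : y \in s' -> y \in c by move=> ys; rewrite -(mem_rot i) E inE ys orbT.
case: s' {E} s'c => [|y s'] s'c; first by [].
case/lastP: s' s'c => [|s' z] s'c; first by [].
rewrite [cycle _ _]/= rcons_path last_rcons => /andP[_ /andP[ys _]] /and3P[xy _ zx] _.
have yE : y = p x by apply: toparent => //; apply: s'c; rewrite inE eqxx.
have zE : z = p x.
  apply: toparent; first by apply: s'c; rewrite inE mem_rcons inE eqxx orbT.
  by rewrite parent_adj_sym.
by rewrite yE -zE mem_rcons inE eqxx in ys.
Qed.

(** The nodes carrying [x] form a subtree below [top x], because from any other of them [x] persists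
    in the bag of the parent. This makes the connectivity condition a local check. *)
Lemma treewidth_le_parent (G : sgraph) (A : finType) (p : A -> A) (r : A -> nat)
    (root : A) (bag : A -> {set G}) (top : G -> A) (k : nat) :
  p root = root -> (forall a, a != root -> r (p a) < r a) ->
  (forall x y, adj x y -> exists a, (x \in bag a) && (y \in bag a)) ->
  (forall x, x \in bag (top x)) ->
  (forall x a, x \in bag a -> a != top x -> a != root /\ x \in bag (p a)) ->
  (forall a, #|bag a| <= k.+1) -> treewidth G <= k.
Proof.
move=> proot rp edge_bag top_bag step card_bag.
have vertexP (x : G) :
    graph_connected (induced [set a : parent_graph p | x \in bag a]).
  set W := [set a : parent_graph p | _].
  have topW : top x \in W by rewrite inE.
  pose u0 : induced W := exist _ (top x) topW.
  split; first by apply/card_gt0P; exists u0.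
  have csym : connect_sym (@adj (induced W)).
    exact: (sym_connect_sym (@adj_sym (induced W))).
  suff totop u : connect (@adj (induced W)) u u0.
    by move=> u v; apply: connect_trans (totop u) _; rewrite csym.
  have [n] := ubnP (r (val u)); elim: n u => // n IH u /ltnSE ru.
  have [ue|une] := eqVneq (val u) (top x).
    by have -> : u = u0; [apply: val_inj | apply: connect0].
  have := valP u; rewrite inE => xu.
  have [uroot xpu] := step x (val u) xu une.
  have pW : p (val u) \in W by rewrite inE.
  have rpu := rp _ uroot.
  have := IH (exist _ (p (val u)) pW) (leq_trans rpu ru).
  apply: connect_trans; apply: connect1; rewrite /= /parent_adj eqxx andbT.
  by apply: contraTneq rpu => <-; rewrite ltnn.
pose D := @TreeDecomposition G (parent_graph p) bag (parent_graph_tree proot rp)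
  edge_bag vertexP.
rewrite /treewidth; case: ex_minnP => m _ min; apply: leq_trans (min (td_width D) _) _.
  by apply/asboolP; exists D.
have : \max_a #|bag a| <= k.+1 by apply/bigmax_leqP.
by rewrite /td_width /=; case: (\max_a _).
Qed.

(* The blow-up G of S gets the following decomposition. Root T; the node of a
   vertex x outside S carries x and its parent (without members of S), the node
   of x in S carries N(x), and every copy i of x in S hangs below the latter
   with bag N(x) + i. *)
Lemma treewidth_blowup (T G : sgraph) (S : {set T}) (k : nat) (phi : G -> option T) :
  forest T -> stable S -> S \subset [set v : T | deg v <= k] ->
  (forall x y : T, adj x y -> 0 < k) ->
  (forall i j : G, adj i j -> exists x y, [/\ phi i = Some x, phi j = Some y & adj x y]) ->
  (forall i j x, phi i = Some x -> phi j = Some x -> x \notin S -> i = j) ->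
  treewidth G <= k.
Proof.
move=> fT stS SL k0 hom injphi.
have [par [r [par1 par2]]] := forest_parent [set: T] fT.
have parP x y : adj x y -> par x = Some y \/ par y = Some x by apply: par1; rewrite inE.
have parE x y : par x = Some y -> adj x y /\ r y < r x.
  by move/par2; rewrite !inE => /(_ isT)[].
have nS x y : x \in S -> adj x y -> y \notin S.
  move=> xS; apply: contraTN => yS.
  by have /forall_inP/(_ _ xS)/forall_inP/(_ _ yS) := stS.
pose bagT x : {set T} := if x \in S then [set y | adj x y]
  else [set y in ~: S | (y == x) || (par x == Some y)].
have bagTS x y : y \in bagT x -> y \notin S.
  by rewrite /bagT; case: ifP => xS; rewrite !inE; [apply: nS | case/andP].
have bagTx x : x \notin S -> x \in bagT x.
  by move=> xS; rewrite /bagT (negPf xS) !inE xS eqxx.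
have card_bagTS x : x \in S -> #|bagT x| <= k.
  by move=> xS; have := subsetP SL _ xS; rewrite /bagT xS inE.
have card_bagT x : #|bagT x| <= k.+1.
  have [/card_bagTS/leqW//|xS] := boolP (x \in S).
  case E: (par x) => [y|].
    apply: leq_trans (_ : #|[set x; y]| <= _).
      apply: subset_leq_card; apply/subsetP => z.
      rewrite /bagT (negPf xS) E !inE => /andP[_ /orP[->//|/eqP[->]]].
      by rewrite eqxx orbT.
    (* Two vertices fit into [k.+1] because the edge to the parent forces [0 < k]. *)
    rewrite cards2; have [/k0 kpos _] := parE _ _ E.
    by case: (_ != _); rewrite // ltnS.
  apply: leq_trans (_ : #|[set x]| <= _); last by rewrite cards1.
  apply: subset_leq_card; apply/subsetP => z.
  by rewrite /bagT (negPf xS) E !inE orbF => /andP[].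
pose bagV x : {set G} := [set i | if phi i is Some y then y \in bagT x else false].
have card_bagV x : #|bagV x| <= #|bagT x|.
  rewrite -(card_in_imset (f := phi)).
    apply: leq_trans (leq_imset_card Some _); apply: subset_leq_card.
    apply/subsetP => _ /imsetP[i + ->]; rewrite inE.
    by case: (phi i) => // y yx; apply: imset_f.
  move=> i j; rewrite !inE; case Ei: (phi i) => [y|] //; case Ej: (phi j) => [z|] //.
  by move=> /bagTS yS _ [yz]; apply: (injphi i j y) => //; rewrite Ej yz.
(* [None] is an added root with empty bag; below it hang the roots of [T] and the vertices of [G]
   that [phi] sends to [None], which are isolated. *)
pose A : finType := option (T + G)%type.
pose p (a : A) : A := match a with
  | None => None
  | Some (inl x) => omap inl (par x)
  | Some (inr i) => omap inl (phi i) end.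
pose rk (a : A) := match a with
  | None => 0
  | Some (inl x) => (r x).+1
  | Some (inr i) => (\max_x r x).+2 end.
pose blown i := if phi i is Some x then x \in S else false.
pose bag (a : A) : {set G} := match a with
  | None => set0
  | Some (inl x) => bagV x
  | Some (inr i) => i |: (if blown i then [set j | adj i j] else set0) end.
(* A copy of a member of [S] occurs only at its own node. A vertex over [x] outside [S] occurs
   highest at the parent of [x] if that lies in [S], where the bag is built from all its neighbours,
   and otherwise at [x]. *)
pose top (i : G) : A := match phi i with
  | None => Some (inr i)
  | Some x => if x \in S then Some (inr i)
    else if par x is Some v then if v \in S then Some (inl v) else Some (inl x)
    else Some (inl x) end.
apply: (@treewidth_le_parent G A p rk None bag top k) => //.
- case=> // -[x|i] _ /=.
    by case E: (par x) => [y|] //=; have [_] := parE _ _ E.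
  by case: (phi i) => //= x; rewrite ltnS ltnS; apply: leq_bigmax.
- move=> i j ij; have [x [y [Ei Ej xy]]] := hom i j ij.
  have [xS|xS] := boolP (x \in S).
    exists (Some (inr i)); rewrite /= /blown Ei xS !inE eqxx /= ij orbT //.
  have [yS|yS] := boolP (y \in S).
    by exists (Some (inr j)); rewrite /= /blown Ej yS !inE eqxx /= adj_sym ij orbT.
  case: (parP _ _ xy) => E; [exists (Some (inl x)) | exists (Some (inl y))];
    by rewrite /= !inE Ei Ej bagTx //= /bagT ?(negPf xS) ?(negPf yS) !inE E eqxx ?orbT ?andbT.
- move=> i; rewrite /top; case Ei: (phi i) => [x|]; last by rewrite /= !inE eqxx.
  have [xS|xS] := boolP (x \in S); first by rewrite /= !inE eqxx.
  case E: (par x) => [v|]; last by rewrite /= inE Ei bagTx.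
  have [vS|vS] := boolP (v \in S); rewrite /= inE Ei; last exact: bagTx.
  by rewrite /bagT vS inE adj_sym; have [] := parE _ _ E.
- move=> i [[x|j]|] /=; last by rewrite inE.
    rewrite inE /top; case Ei: (phi i) => [y|] // yx.
    have yS := bagTS _ _ yx; rewrite (negPf yS) => ne; split=> //.
    have [xy|E] : y = x \/ par x = Some y \/ (x \in S /\ par y = Some x).
    + move: yx; rewrite /bagT; case: ifP => xS; rewrite !inE.
        by case/parP => ?; right; [left|right].
      by case/andP=> _ /orP[/eqP|/eqP]; [left|right; left].
    + rewrite -xy in ne *; move: ne; case E: (par y) => [v|]; last by rewrite eqxx.
      case: ifP => vS; last by rewrite eqxx.
      by move=> _ /=; rewrite inE Ei /bagT vS inE adj_sym; have [] := parE _ _ E.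
    + case: E => [E|[xS E]]; first by rewrite E /= inE Ei bagTx.
      by rewrite E xS eqxx in ne.
  rewrite !inE => ij ne; split=> //; case/orP: ij => [/eqP ij|].
    rewrite -{j}ij in ne *; move: ne; rewrite /top.
    case Ei: (phi i) => [y|]; last by rewrite eqxx.
    by have [yS|yS] := boolP (y \in S); rewrite ?eqxx //= inE Ei bagTx.
  rewrite /blown; case Ej: (phi j) => [x|]; last by rewrite inE.
  case: ifP => xS; rewrite inE // => ji.
  have [x' [y [Ex' Ei xy]]] := hom j i ji; move: Ex'; rewrite Ej => -[xx'].
  by rewrite /= inE Ei /bagT xS inE xx'.
- case=> [[x|i]|] /=; last by rewrite cards0.
    exact: leq_trans (card_bagV x) (card_bagT x).
  rewrite /blown; case Ei: (phi i) => [x|]; last by rewrite finset.setU0 cards1.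
  case: ifP => xS; last by rewrite finset.setU0 cards1.
  apply: leq_trans (leq_card_setU _ _) _; rewrite cards1 add1n ltnS.
  apply: leq_trans (card_bagTS _ xS); apply: leq_trans (card_bagV x).
  apply: subset_leq_card; apply/subsetP => j; rewrite !inE => ij.
  have [x' [y [Ex' -> xy]]] := hom i j ij.
  by move: Ex'; rewrite Ei => -[xx']; rewrite /bagT xS inE xx'.
Qed.

(* The vertex i of 'I_n is a copy of the vertex of T with index i mod h; outside
   S only the first copy is kept, the others become isolated. *)
Lemma blowup_many_copies (T : sgraph) (S : {set T}) (k d h n : nat) :
  forest T -> stable S -> S \subset [set v : T | deg v <= k] ->
  (forall x y : T, adj x y -> 0 < k) -> #|T| = h -> 0 < h -> h <= n ->
  exists G : sgraph, [/\ #|G| = n, treewidth G <= k &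
    (n %/ h) ^ #|S| <= copies T (power d G)].
Proof.
move=> fT stS SL k0 hT h0 hn.
have modh (i : nat) : i %% h < #|T| by rewrite hT ltn_mod.
pose cls (i : nat) : T := enum_val (Ordinal (modh i)).
pose phi (i : 'I_n) := if (i < h) || (cls i \in S) then Some (cls i) else None.
pose e : rel 'I_n := fun i j =>
  if phi i is Some x then (if phi j is Some y then adj x y else false) else false.
have esym : symmetric e.
  by move=> i j; rewrite /e; case: (phi i) (phi j) => [x|] [y|] //; apply: adj_sym.
have eirr : irreflexive e by move=> i; rewrite /e; case: (phi i) => // x; apply: adj_irr.
pose G := SGraph esym eirr; exists G; split; first exact: card_ord.
  apply: (@treewidth_blowup T G S k phi) => //.
    move=> i j; rewrite /= /e; case: (phi i) => // x; case: (phi j) => // y xy.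
    by exists x, y.
  move=> i j x; rewrite /phi; case: ifP => // ia [clsi]; case: ifP => // ja [clsj] xS.
  move: ia ja; rewrite clsi clsj (negPf xS) !orbF => ih jh.
  have /enum_val_inj/(congr1 val) /= : cls i = cls j by rewrite clsi.
  by rewrite !modn_small // => ij; apply: val_inj.
have m0 : 0 < n %/ h by rewrite divn_gt0.
case Em: (n %/ h) m0 => [//|m] _.
(* [g x] numbers the copy used for [x]; off [S] it must be 0, the only copy kept. *)
pose F := [set g : {ffun T -> 'I_m.+1} | g \in pffun_on ord0 (mem S) predT].
have -> : m.+1 ^ #|S| = #|F|.
  by rewrite cardsE card_pffun_on (eq_card (B := 'I_m.+1)) ?card_ord.
have rkh (x : T) : enum_rank x < h by rewrite -hT.
have ltn (g : {ffun T -> 'I_m.+1}) x : g x * h + enum_rank x < n.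
  have : m.+1 * h <= n by rewrite -Em leq_divM.
  have := rkh x; have := ltn_ord (g x); nia.
pose f (g : {ffun T -> 'I_m.+1}) x : power d G := Ordinal (ltn g x).
have clsf g x : cls (f g x) = x.
  apply: enum_rank_inj; rewrite /cls enum_valK; apply: val_inj => /=.
  by rewrite modnMDl modn_small.
have phif g x : g \in F -> phi (f g x) = Some x.
  rewrite inE => /pffun_onP[/subsetP gS _]; rewrite /phi clsf.
  have [xS|xS] := boolP (x \in S); first by rewrite orbT.
  have gx0 : g x = ord0 by apply/eqP; apply: contraNT xS => /gS.
  by rewrite /= gx0 mul0n add0n rkh.
apply: (@card_le_copies T (power d G) _ F f).
  move=> g gF; split=> [x y fxy|x y xy].
    by have := phif g x gF; rewrite fxy phif // => -[].
  rewrite /= /power_adj /= /e !phif // xy andbT.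
  apply: contraTneq xy => fxy.
  by have := phif g x gF; rewrite fxy phif // => -[->]; rewrite adj_irr.
move=> g g' gF gF' /= E; apply/ffunP => x; apply: val_inj.
(* The only vertex over [x] in the image of [f g'] is [f g' x], so the vertex set determines [g]. *)
have : f g x \in f g' @: [set: T] by rewrite -E imset_f.
case/imsetP => y _ fxy; have := phif g x gF; rewrite fxy phif // => -[yx].
move/(congr1 val): fxy; rewrite yx /= => /eqP.
by rewrite eqn_add2r eqn_pmul2r // => /eqP.
Qed.

(* Densities and asymptotics *)
From mathcomp Require Import classical_sets reals ereal topology.
From mathcomp Require Import normedtype landau sequences.
Import Order.TTheory GRing.Theory Num.Theory.
Import numFieldNormedType.Exports.

Local Open Scope ring_scope.
Local Open Scope classical_set_scope.

Lemma class_edges_le (R : realType) (rho : R) (C : graph_class) :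
  (class_density R C <= rho%:E)%E ->
  exists c : nat, forall G : sgraph, C G -> (#|edges G| <= c * #|G|)%N.
Proof.
move=> le; exists (Num.bound `|rho|%R) => G CG.
have dens : (density R G <= rho)%R.
  rewrite -lee_fin; apply: le_trans le; apply: ereal_sup_ubound.
  by exists G.
(* The null graph is treated apart, as its density is a division by 0. *)
have [V0|V0] := posnP #|G|.
  rewrite V0 muln0 leqNgt; apply/negP => /card_gt0P[_ /imsetP[[x y] _ _]].
  by have := fintype0 x V0.
rewrite -(ler_nat R) natrM -ler_pdivrMr ?ltr0n //.
by apply: le_trans dens _; apply: le_trans (ler_norm _) _; apply/ltW/archi_boundP/normr_ge0.
Qed.

(** To stay within natural numbers, the lower bound carries its constant on the right; [c.+1] serves
    above because the constant must be positive. *)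
Lemma theta_of_bounds (R : realType) (u : nat -> nat) (a c h N : nat) :
  (0 < h)%N ->
  (forall n, (N <= n)%N -> (u n <= c * n ^ a)%N /\ (n ^ a <= h * u n)%N) ->
  (fun n => (u n)%:R : R^o) \is 'Theta_\oo (fun n : nat => n%:R ^+ a : R^o).
Proof.
move=> h0 bounds.
have h0' : (0 < h%:R :> R)%R by rewrite ltr0n.
apply/asboolP; exists (h%:R^-1, c.+1%:R)%R => /=.
  by rewrite invr_gt0 h0' ltr0n.
exists N => // n /bounds[up lo] /=.
rewrite -natrX !normr_nat; split.
  by rewrite mulrC ler_pdivrMr // -natrM ler_nat mulnC.
by rewrite -natrM ler_nat (leq_trans up) // leq_mul2r leqnSn orbT.
Qed.

(** The count assumes [1 < s] or an edgeless [T]. Otherwise it can fail: for [s = 1] the class of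
    all edgeless graphs meets the other hypotheses, yet a single edge [T] has no copy there, while
    its [alpha 0 T] is 0 and [n ^ 0 = 1]. *)
Theorem theorem12 (R : realType) (s t d h : nat) (rho : R) (T : sgraph)
    (C : graph_class) :
  (0 < s)%N -> (0 < t)%N -> (0 < d)%N -> (0 < h)%N -> 0 <= rho ->
  forest T -> #|T| = h ->
  (class_density R C <= rho%:E)%E ->
  (forall G : sgraph, (treewidth G <= s - 1)%N -> C G) ->
  (forall G : sgraph, C G -> ~ has_model 1 (2 * h + s - 1)%N s t G) ->
  let t' := ((2 * d * (s + h - 1) + 1) * (t - 1) + 1 + s * d)%N in
  (forall G : sgraph, power_class d C G -> ~ has_model 1 h s t' G) /\
  ((1 < s)%N \/ edges T = finset.set0 ->
   (fun n : nat => (max_copies T (power_class d C) n)%:R : R^o) \is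
     'Theta_\oo (fun n : nat => n%:R ^+ alpha (s - 1) T : R^o)).
Proof.
move=> s0 t0 _ h0 _ fT hT dens twC noM t'.
have noM' G : power_class d C G -> ~ has_model 1 h s t' G.
  by case=> G' CG' ->; apply: power_no_model (noM _ CG').
split=> // sT.
have [c cE] := class_edges_le dens.
have t'0 : (0 < t')%N by rewrite /t' addn1 addSn.
have [S [stS SL cS]] := alpha_attained (s - 1) T.
set a := alpha (s - 1) T in cS *.
pose K := ((4 * c + d * d).+1 ^ a * (t' * h * h).+1 ^ h)%N.
apply: (@theta_of_bounds R _ a K ((2 * h) ^ a) h); first by rewrite expn_gt0 muln_gt0 h0.
move=> n hn; have n0 : (0 < n)%N := leq_trans h0 hn; split.
  apply/bigmax_leqP => k /asboolP[_ [[G CG ->] cG <-]].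
  have noMG := noM' _ (ex_intro2 _ _ G CG erefl).
  have Gn : #|G| = n := cG.
  apply: leq_trans (copies_power_le fT hT s0 sT t'0 noMG (cE G CG) _) _.
    by rewrite Gn.
  by rewrite Gn expnMn /K -/a mulnAC.
have kpos (x y : T) : adj x y -> (0 < s - 1)%N.
  by case: sT => [|E0]; [lia | rewrite -adjacent_in_edges E0 inE].
have [G [Gn twG many]] := blowup_many_copies d fT stS SL kpos hT h0 hn.
have := @copies_le_max T (power_class d C) (power d G) (ex_intro2 _ _ G (twC G twG) erefl).
rewrite (_ : #|power d G| = n) // => le_max.
(* For [n] at least [h], rounding down loses at most a factor 2, whence the constant
   [(2 * h) ^ a]. *)
have n_le : (n <= 2 * h * (n %/ h))%N.
  by have := ltn_pmod n h0; have := divn_eq n h; have := divn_gt0 n h0; nia.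
have mono : (n ^ a <= (2 * h * (n %/ h)) ^ a)%N.
  by case: (a) => // a'; rewrite leq_exp2r.
apply: leq_trans mono _; rewrite expnMn leq_mul2l; apply/orP; right; rewrite -cS.
exact: leq_trans many le_max.
Qed.
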